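(* Let $N\ge2$. Let $d(s)$ be a real monic polynomial of degree $N$ whose zeros $\delta_1,\dots,\delta_N$ are distinct and lie in the open left half plane, and let $e(s)$ be a real polynomial of degree at most $N-1$, coprime to $d$, so that $e/d\in\Sigma S_N$. Let $$M=\mathrm{diag}(e(\delta_1),\dots,e(\delta_N))\,V(\delta_1,\dots,\delta_N)\,V(-\delta_1,\dots,-\delta_N)^{-1},$$ and let $\Xi$ be the set of $x\in\mathbb{C}^N\setminus\{0\}$ satisfying $x_i^2=(Mx)_i$ for $i=1,\dots,N$. (i) The number of critical points of the function $f:\Sigma S_{N-1}\to[0,\infty)$, $f(b/a)=\|e/d-b/a\|_2^2$, is finite and at most $2^N-1$. (ii) If $b/a\in\Sigma S_{N-1}$ (with $a$ monic) is a critical point of $f$, then there exist a number $q_0$ and a vector $\xi\in\Xi$ such that $q_0a(-\delta_i)=\xi_i$ for $i=1,\dots,N$. For given $q_0$ and $\xi$, the polynomial $a$ is uniquely determined by this linear system, and $b$ is uniquely determined by $b(s)=\bigl(e(s)a(s)-q_0a(-s)^2\bigr)/d(s)$.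
   Context: $V(\delta_1,\dots,\delta_N)$ is the $N\times N$ Vandermonde matrix whose $i$-th row is $(1,\delta_i,\delta_i^2,\dots,\delta_i^{N-1})$. For $n\ge1$, $\Sigma S_n$ denotes the set (a differentiable manifold) of real rational functions $b(s)/a(s)$ with $a,b$ real coprime polynomials, $a$ a monic Hurwitz polynomial (all zeros in the open left half plane) of degree $n$ and $\deg b<n$. For such strictly proper stable rational functions $t$, $\|t\|_2^2=\frac{1}{2\pi}\int_{-\infty}^{\infty}|t(i\omega)|^2\,d\omega$ (the $H_2$ norm). A critical point of $f$ is a point of the manifold $\Sigma S_{N-1}$ where the differential of $f$ vanishes. *)

(* Defs.v *)
From HB Require Import structures.
From mathcomp Require Import all_boot all_order all_algebra.
From mathcomp Require Import all_classical all_reals all_analysis.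
From mathcomp Require Import complex.
Set Implicit Arguments. Unset Strict Implicit. Unset Printing Implicit Defensive.
Import Order.TTheory GRing.Theory Num.Theory.
Import numFieldNormedType.Exports.
Local Open Scope ring_scope.
Local Open Scope complex_scope.

Section Defs.
Variable R : realType.

Definition polC (p : {poly R}) : {poly R[i]} := map_poly (real_complex R) p.

Definition abs2 (z : R[i]) : R := complex.Re z ^+ 2 + complex.Im z ^+ 2.

Definition hurwitz (a : {poly R}) : Prop :=
  forall z : R[i], root (polC a) z -> complex.Re z < 0.

(* (a, b) represents b/a in Sigma S_n : a monic Hurwitz of degree n,
   deg b < n, a and b coprime *)
Definition SigmaS (n : nat) (a b : {poly R}) : Prop :=
  [/\ a \is monic, size a = n.+1, hurwitz a, (size b <= n)%N & coprimep a b].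

Definition H2sq (num den : {poly R}) : R :=
  (2 * pi)^-1 * (\int[lebesgue_measure]_(w in [set: R])
     (abs2 (polC num).[(w%:C * 'i)%C] / abs2 (polC den).[(w%:C * 'i)%C]))%R.

(* global chart of Sigma S_n by coefficients: a = X^n + sum x_k X^k,
   b = sum y_k X^k *)
Definition chart_a (n : nat) (x : 'rV[R]_n) : {poly R} :=
  'X^n + \sum_(k < n) x ord0 k *: 'X^k.
Definition chart_b (n : nat) (y : 'rV[R]_n) : {poly R} :=
  \sum_(k < n) y ord0 k *: 'X^k.
Definition coords (n : nat) (p : {poly R}) : 'rV[R]_n := \row_(k < n) p`_k.
Arguments coords n p : clear implicits.

(* f(b/a) = || e/d - b/a ||_2^2 = || (e a - b d)/(d a) ||_2^2 in the chart *)
Definition f_chart (n : nat) (e d : {poly R}) (p : 'rV[R]_n * 'rV[R]_n) : R :=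
  H2sq (e * chart_a p.1 - chart_b p.2 * d) (d * chart_a p.1).
Arguments f_chart n e d p : clear implicits.

Definition critical (n : nat) (e d a b : {poly R}) : Prop :=
  SigmaS n a b /\
  differentiable (f_chart n e d) (coords n a, coords n b) /\
  forall v, 'd (f_chart n e d) (coords n a, coords n b) v = 0.

Definition vdm (N : nat) (x : 'I_N -> R[i]) : 'M[R[i]]_N :=
  \matrix_(i < N, j < N) x i ^+ j.

Definition Mmat (N : nat) (e : {poly R}) (dl : 'I_N -> R[i]) : 'M[R[i]]_N :=
  diag_mx (\row_(i < N) (polC e).[dl i]) *m vdm dl
    *m invmx (vdm (fun i => - dl i)).

Definition Xi (N : nat) (e : {poly R}) (dl : 'I_N -> R[i]) (x : 'cV[R[i]]_N)
  : Prop :=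
  x != 0 /\ forall i, x i ord0 ^+ 2 = (Mmat e dl *m x) i ord0.

End Defs.

(* Main.v *)
Require Import Defs.
From HB Require Import structures.
From mathcomp Require Import all_boot all_order all_algebra.
From mathcomp Require Import all_classical all_reals all_analysis.
From mathcomp Require Import complex.
From mathcomp Require Import measurable_realfun.
From mathcomp Require Import ring lra zify.
Import Order.TTheory GRing.Theory Num.Theory.
Import numFieldNormedType.Exports.
Local Open Scope ring_scope.

Set Implicit Arguments. Unset Strict Implicit. Unset Printing Implicit Defensive.

(** Moving (a, b) along (u, v) changes b/a to first order by -c/a^2 with
    c = b u - v a, and coprimality of a and b makes c an arbitrary polynomial of
    degree < 2(N-1).  So at a critical point the error h = (e a - b d)/(d a) is
    orthogonal, on the imaginary axis, to every c/a^2.  Projecting h onto these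
    functions leaves a remainder divisible by a(-s)^2, and its inner product with
    c/a^2 is the integral of a stable rational function decaying like s^-2, which
    vanishes; hence the projection is zero and a(-s)^2 divides e a - b d, i.e.
    e a - b d = q0 a(-s)^2 by degree.  Evaluating at the zeros of d gives
    xi_i^2 = (M xi)_i for xi_i = q0 a(-delta_i), and xi determines q0, a and b.
    Finally a system x_i^2 = (M x)_i has at most 2^N solutions, because modulo
    these equations the 2^N squarefree monomials span all polynomial functions on
    a finite set of solutions; one of the solutions is 0. *)

(** * Number of solutions of a diagonal system of quadrics *)

(** The rows of [E] are the squarefree monomials evaluated at the solutions: their
    span is stable under multiplication by each coordinate, hence contains the
    indicator function of each solution. *)
Lemma diagonal_quadrics_solutions_le (F : fieldType) (N : nat) (M : 'M[F]_N)
    (s : seq 'cV[F]_N) :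
  uniq s ->
  (forall x, x \in s -> forall i, x i ord0 ^+ 2 = (M *m x) i ord0) ->
  (size s <= 2 ^ N)%N.
Proof.
move=> us sol; set k := size s.
pose pt (j : 'I_k) := tnth (in_tuple s) j.
have ptP j i : pt j i ord0 ^+ 2 = \sum_l M i l * pt j l ord0.
  by rewrite sol ?mem_tnth// mxE.
pose mono (S : {set 'I_N}) : 'rV[F]_k := \row_j \prod_(i in S) pt j i ord0.
pose D i : 'M[F]_k := diag_mx (\row_j pt j i ord0).
pose E : 'M[F]_(#|{set 'I_N}|, k) := \matrix_(r, j) mono (enum_val r) ord0 j.
have rE r : row r E = mono (enum_val r).
  by apply/rowP => j; rewrite !mxE.
have monoE S : (mono S <= E)%MS.
  by rewrite -[S]enum_rankK -rE row_sub.
have mulD (v : 'rV[F]_k) i j : (v *m D i) ord0 j = v ord0 j * pt j i ord0.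
  by rewrite mul_mx_diag !mxE.
have monoD m (S : {set 'I_N}) (i : 'I_N) : (#|S| < m)%N -> (mono S *m D i <= E)%MS.
  elim: m S i => // m IH S i; rewrite ltnS => Sm.
  have [iS|iS] := boolP (i \in S); last first.
    suff -> : mono S *m D i = mono (i |: S) by [].
    by apply/rowP => j; rewrite mulD !mxE big_setU1//= mulrC.
  (* The product contains the square of coordinate i; the equation replaces it by a linear form, and
     each term then multiplies the smaller monomial of [S :\ i], to which induction applies. *)
  have -> : mono S *m D i = \sum_l M i l *: (mono (S :\ i) *m D l).
    apply/rowP => j; rewrite mulD summxE.
    under eq_bigr do rewrite mxE mulD mxE mulrCA.
    by rewrite -mulr_sumr -ptP mxE (big_setD1 i)//= expr2; ring.
  apply: summx_sub => l _; apply/scalemx_sub/IH.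
  by move: Sm; rewrite (cardsD1 i S) iS add1n.
have subD (v : 'rV[F]_k) i : (v <= E)%MS -> (v *m D i <= E)%MS.
  move=> vE; apply: (submx_trans (submxMr _ vE)).
  by apply/row_subP => r; rewrite row_mul rE (monoD #|enum_val r|.+1).
(* As in Lagrange interpolation, a factor x_i - (pt j)_i, with i a coordinate separating [pt j] from
   [pt j0], kills the point j and keeps j0. *)
have sepE (j0 : 'I_k) (r : seq 'I_k) : j0 \notin r -> exists v : 'rV[F]_k,
    [/\ (v <= E)%MS, v ord0 j0 != 0 & forall j, j \in r -> v ord0 j = 0].
  elim: r => [_|j r IH].
    by exists (mono finset.set0); split; rewrite // mxE big_set0 oner_neq0.
  rewrite inE negb_or => /andP[j0j /IH[v [vE v0 vr]]].
  have [i ji] : exists i, pt j0 i ord0 != pt j i ord0.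
    have : pt j0 - pt j != 0 by rewrite subr_eq0 (inj_eq (elimT (tuple_uniqP (in_tuple s)) us)).
    by case/cV0Pn => i; rewrite !mxE subr_eq0; exists i.
  have wE j' : (v *m D i - pt j i ord0 *: v) ord0 j' =
      v ord0 j' * (pt j' i ord0 - pt j i ord0).
    by rewrite mxE mulD !mxE; ring.
  exists (v *m D i - pt j i ord0 *: v); split.
  - by rewrite addmx_sub ?subD// eqmx_opp scalemx_sub.
  - by rewrite wE mulf_neq0// subr_eq0.
  - by move=> j'; rewrite inE wE => /predU1P[->|/vr ->]; rewrite (subrr, mul0r) ?mulr0.
(* Indicators of single points are the rows of the identity, so [E] has rank k, which cannot exceed
   its 2^N rows. *)
have : (1%:M <= E)%MS.
  apply/row_subP => j0; rewrite row1.
  have [|v [vE v0 vr]] := sepE j0 [seq j <- ord_enum k | j != j0].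
    by rewrite mem_filter eqxx.
  have -> : delta_mx 0 j0 = (v ord0 j0)^-1 *: v; last exact: scalemx_sub.
  apply/rowP => j; rewrite !mxE/=; have [->|jj0] := eqVneq j j0.
    by rewrite mulVf.
  have /vr -> : j \in [seq j <- ord_enum k | j != j0].
    by rewrite mem_filter jj0 mem_ord_enum.
  by rewrite mulr0.
move/mxrankS; rewrite mxrank1 => /leq_trans; apply.
by rewrite (leq_trans (rank_leq_row E))// -cardsT -powersetT card_powerset cardsT card_ord.
Qed.

(** * Rational functions on the imaginary axis: continuity and decay *)

Section ImaginaryAxis.
Variable R : realType.
Local Notation C := R[i].
Local Open Scope complex_scope.
Implicit Types (z : C) (X D : {poly C}) (w : R).

Definition jw w : C := (w%:C * 'i)%C.

(** The inner product of C seen as R^2; it is the cross term when [abs2] of a sum is expanded. *)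
Definition dotc z1 z2 : R :=
  complex.Re z1 * complex.Re z2 + complex.Im z1 * complex.Im z2.

Lemma jwE w : jw w = 0 +i* w.
Proof. by rewrite /jw; simpc. Qed.

Lemma cReM z1 z2 : complex.Re (z1 * z2) =
  complex.Re z1 * complex.Re z2 - complex.Im z1 * complex.Im z2.
Proof. by case: z1 z2 => a b [c d]. Qed.

Lemma cImM z1 z2 : complex.Im (z1 * z2) =
  complex.Re z1 * complex.Im z2 + complex.Im z1 * complex.Re z2.
Proof. by case: z1 z2 => a b [c d]. Qed.

Lemma cReV z : complex.Re z^-1 = complex.Re z / abs2 z.
Proof. by case: z. Qed.

Lemma cImV z : complex.Im z^-1 = - (complex.Im z / abs2 z).
Proof. by case: z. Qed.

Lemma abs2_ge0 z : 0 <= abs2 z.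
Proof. by rewrite addr_ge0 ?sqr_ge0. Qed.
Hint Resolve abs2_ge0 : core.

Lemma abs2_eq0 z : (abs2 z == 0) = (z == 0).
Proof.
case: z => a b; rewrite /abs2/= paddr_eq0 ?sqr_ge0// !sqrf_eq0.
by rewrite eq_complex.
Qed.

Lemma abs2_gt0 z : (0 < abs2 z) = (z != 0).
Proof. by rewrite lt0r abs2_eq0 abs2_ge0 andbT. Qed.

Lemma abs2M z1 z2 : abs2 (z1 * z2) = abs2 z1 * abs2 z2.
Proof. by rewrite /abs2 cReM cImM; ring. Qed.

Lemma abs2V z : abs2 z^-1 = (abs2 z)^-1.
Proof.
have [->|z0] := eqVneq z 0; first by rewrite invr0 /abs2/= expr0n addr0 invr0.
apply: (@mulfI _ (abs2 z)); rewrite ?abs2_eq0// -abs2M !divff ?abs2_eq0//.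
by rewrite /abs2/= expr0n expr1n addr0.
Qed.

Lemma abs2_div z1 z2 : abs2 (z1 / z2) = abs2 z1 / abs2 z2.
Proof. by rewrite abs2M abs2V. Qed.

Lemma abs2_real (t : R) : abs2 t%:C = t ^+ 2.
Proof. by rewrite /abs2/= expr0n addr0. Qed.

Lemma abs2D_le z1 z2 : abs2 (z1 + z2) <= 2 * abs2 z1 + 2 * abs2 z2.
Proof.
case: z1 z2 => a b [c d]; rewrite /abs2/=.
have := sqr_ge0 (a - c); have := sqr_ge0 (b - d); nra.
Qed.

Lemma dotc_le z1 z2 : `|2 * dotc z1 z2| <= abs2 z1 + abs2 z2.
Proof.
case: z1 z2 => a b [c d]; rewrite ler_norml /abs2 /dotc/=.
have := sqr_ge0 (a - c); have := sqr_ge0 (b - d).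
have := sqr_ge0 (a + c); have := sqr_ge0 (b + d).
by move=> *; apply/andP; split; nra.
Qed.

Lemma abs2D z1 z2 : abs2 (z1 + z2) = abs2 z1 + 2 * dotc z1 z2 + abs2 z2.
Proof. by case: z1 z2 => a b [c d]; rewrite /abs2/dotc/=; ring. Qed.

Lemma abs2_dotc z : abs2 z = dotc z z.
Proof. by rewrite /abs2/dotc !expr2. Qed.

Lemma dotcE z1 z2 : dotc z1 z2 = complex.Re (z1 * conjc z2).
Proof. by case: z1 z2 => a b [c d]; rewrite /dotc/=; ring. Qed.

(** Continuity is taken componentwise, so that only real-valued functions have to be handled. *)
Definition ccont (f : R -> C) : Prop :=
  continuous (fun w => complex.Re (f w)) /\ continuous (fun w => complex.Im (f w)).

Lemma ccont_cst z : ccont (fun=> z).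
Proof. by split=> w; apply: cvg_cst. Qed.

Lemma ccont_jw : ccont jw.
Proof.
split.
  rewrite (_ : (fun _ => _) = cst 0); last by apply/funext => w; rewrite jwE.
  by move=> w; apply: cvg_cst.
rewrite (_ : (fun _ => _) = id); last by apply/funext => w; rewrite jwE.
by move=> w; apply: cvg_id.
Qed.

Lemma cReD z1 z2 : complex.Re (z1 + z2) = complex.Re z1 + complex.Re z2.
Proof. by case: z1 z2 => a b [c d]. Qed.

Lemma cImD z1 z2 : complex.Im (z1 + z2) = complex.Im z1 + complex.Im z2.
Proof. by case: z1 z2 => a b [c d]. Qed.

Lemma ccontD f g : ccont f -> ccont g -> ccont (fun w => f w + g w).
Proof.
move=> [fr fi] [gr gi]; split.
  by under eq_fun do rewrite cReD; move=> w; apply: cvgD; [exact: fr|exact: gr].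
by under eq_fun do rewrite cImD; move=> w; apply: cvgD; [exact: fi|exact: gi].
Qed.

Lemma ccontM f g : ccont f -> ccont g -> ccont (fun w => f w * g w).
Proof.
move=> [fr fi] [gr gi]; split.
  under eq_fun do rewrite cReM; move=> w; apply: cvgB; apply: cvgM.
  - exact: fr.
  - exact: gr.
  - exact: fi.
  - exact: gi.
under eq_fun do rewrite cImM; move=> w; apply: cvgD; apply: cvgM.
- exact: fr.
- exact: gi.
- exact: fi.
- exact: gr.
Qed.

Lemma continuous_dotc f g : ccont f -> ccont g ->
  continuous (fun w => dotc (f w) (g w)).
Proof.
move=> [fr fi] [gr gi] w; apply: cvgD; apply: cvgM.
- exact: fr.
- exact: gr.
- exact: fi.
- exact: gi.
Qed.

Lemma continuous_abs2 f : ccont f -> continuous (fun w => abs2 (f w)).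
Proof. by move=> cf; under eq_fun do rewrite abs2_dotc; exact: continuous_dotc. Qed.

Lemma ccontV f : ccont f -> (forall w, f w != 0) -> ccont (fun w => (f w)^-1).
Proof.
move=> cf f0; have ca := continuous_abs2 cf; case: cf => fr fi.
have cV : continuous (fun w => (abs2 (f w))^-1).
  by move=> w; apply: cvgV; [rewrite abs2_eq0|exact: ca].
split.
  under eq_fun do rewrite cReV; move=> w; apply: cvgM; [exact: fr|exact: cV].
under eq_fun do rewrite cImV.
move=> w; apply: cvgN; apply: cvgM; [exact: fi|exact: cV].
Qed.

Lemma ccont_horner X : ccont (fun w => X.[jw w]).
Proof.
elim/poly_ind: X => [|X c IH].
  by under eq_fun do rewrite horner0; exact: ccont_cst.
under eq_fun do rewrite hornerMXaddC.
by apply: ccontD (ccont_cst _); apply: ccontM ccont_jw.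
Qed.

Lemma ccont_ratio X D : (forall w, D.[jw w] != 0) ->
  ccont (fun w => X.[jw w] / D.[jw w]).
Proof. by move=> D0; apply: ccontM (ccontV _ D0); exact: ccont_horner. Qed.

Lemma abs2_horner_ub X n : (size X <= n.+1)%N ->
  exists2 K : R, 0 <= K & forall w, abs2 X.[jw w] <= K * (1 + w ^+ 2) ^+ n.
Proof.
elim: n X => [|n IH] X sX.
  by exists (abs2 X`_0) => // w; rewrite (size1_polyC sX) hornerC coefC/= mulr1.
elim/poly_ind: X sX => [_|X c _ sX].
  by exists 0 => // w; rewrite horner0 /abs2/= expr0n addr0 mul0r.
have [|K K0 XK] := IH X.
  by move: sX; rewrite size_MXaddC; case: ifP => // /andP[/eqP -> _]; rewrite size_poly0.
exists (2 * K + 2 * abs2 c) => [|w].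
  by rewrite addr_ge0// mulr_ge0.
rewrite hornerMXaddC (le_trans (abs2D_le _ _))// [leRHS]mulrDl lerD//.
  rewrite -mulrA ler_pM2l// abs2M exprSr mulrA ler_pM// jwE /abs2/= expr0n add0r.
  by rewrite lerDr.
by rewrite -[leLHS]mulr1 ler_wpM2l ?mulr_ge0// exprn_ege1// lerDl sqr_ge0.
Qed.

Lemma abs2_jwB_lb z : complex.Re z != 0 ->
  exists2 k : R, 0 < k & forall w, k * (1 + w ^+ 2) <= abs2 (jw w - z).
Proof.
case: z => p q /= p0; have p2 : 0 < p ^+ 2 by rewrite exprn_even_gt0.
have q2 : 0 <= 1 + 2 * q ^+ 2 by have := sqr_ge0 q; lra.
have K0 : 0 < 2 + (1 + 2 * q ^+ 2) / p ^+ 2.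
  by rewrite ltr_wpDr// divr_ge0// ltW.
(* The constant comes from 1 + w^2 <= 2 (w - q)^2 + (1 + 2 q^2) together with p^2 <=
   [abs2 (jw w - z)]. *)
exists (2 + (1 + 2 * q ^+ 2) / p ^+ 2)^-1 => [|w]; first by rewrite invr_gt0.
rewrite mulrC ler_pdivrMr// jwE /abs2/= add0r sqrrN mulrDr.
have -> : (p ^+ 2 + (w - q) ^+ 2) * ((1 + 2 * q ^+ 2) / p ^+ 2) =
  1 + 2 * q ^+ 2 + (w - q) ^+ 2 * (1 + 2 * q ^+ 2) / p ^+ 2.
  by field.
have : 0 <= (w - q) ^+ 2 * (1 + 2 * q ^+ 2) / p ^+ 2.
  by apply: divr_ge0 (ltW p2); apply: mulr_ge0 q2; exact: sqr_ge0.
move: (_ / p ^+ 2) => u u0; have := sqr_ge0 (w - 2 * q); nra.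
Qed.

(** Over C, [D] splits into linear factors whose roots are off the imaginary axis, and [abs2_jwB_lb]
    bounds each factor from below. *)
Lemma abs2_horner_lb D : (forall w, D.[jw w] != 0) ->
  exists2 k : R, 0 < k &
    forall w, k * (1 + w ^+ 2) ^+ (size D).-1 <= abs2 D.[jw w].
Proof.
move=> D0.
have [r Dr] := closed_field_poly_normal D.
have l0 : lead_coef D != 0.
  by rewrite lead_coef_eq0; apply: contraNneq (D0 0) => ->; rewrite horner0.
have {D0}: forall z, z \in r -> complex.Re z != 0.
  move=> z zr; apply: contraNneq (D0 (complex.Im z)) => z0.
  suff -> : jw (complex.Im z) = z by rewrite -rootE Dr rootZ// root_prod_XsubC.
  by rewrite jwE; case: z z0 {zr} => /= a b ->.
rewrite Dr size_scale// size_prod_XsubC/= => rP.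
have [k k0 kP] : exists2 k : R, 0 < k & forall w, k * (1 + w ^+ 2) ^+ size r <=
    abs2 (\prod_(z <- r) ('X - z%:P)).[jw w].
  elim: r rP {Dr} => [_|z r IH rP].
    by exists 1 => // w; rewrite big_nil hornerC /abs2/= expr0n expr1n addr0 mulr1.
  have [|k k0 kP] := IH; first by move=> x xr; rewrite rP// inE xr orbT.
  have [|l {}l0 lP] := @abs2_jwB_lb z; first by rewrite rP// mem_head.
  exists (l * k) => [|w]; first exact: mulr_gt0.
  rewrite big_cons hornerM hornerXsubC abs2M /= exprS mulrACA.
  have Q0 : 0 <= 1 + w ^+ 2 by rewrite addr_ge0 ?sqr_ge0.
  by rewrite ler_pM// mulr_ge0// ?exprn_ge0// ltW.
exists (abs2 (lead_coef D) * k) => [|w]; first by rewrite mulr_gt0// abs2_gt0.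
by rewrite hornerZ abs2M -mulrA ler_wpM2l.
Qed.

(** Source of the dominating functions K / (1 + w^2) in the integrability arguments: the upper bound
    on the numerator is divided by the lower bound on the denominator. *)
Lemma abs2_ratio_decay X D : (size X < size D)%N -> (forall w, D.[jw w] != 0) ->
  exists2 K : R, 0 <= K &
    forall w, abs2 (X.[jw w] / D.[jw w]) <= K / (1 + w ^+ 2).
Proof.
move=> XD D0.
(* Comparing the two bounds needs deg D >= 1; a constant [D] forces X = 0 and is treated apart. *)
have D2 : (size D).-1 = (size D).-2.+1 \/ (size D = 1)%N.
  by case: (size D) XD => [//|[|m]] _; [right|left].
case: D2 => D2; last first.
  move: XD; rewrite D2 ltnS leqn0 size_poly_eq0 => /eqP ->.
  by exists 0 => // w; rewrite horner0 mul0r /abs2/= expr0n addr0 mul0r.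
have [|K K0 XK] := @abs2_horner_ub X (size D).-2.
  by rewrite -D2 -ltnS prednK ?(leq_ltn_trans _ XD).
have [k k0 kD] := abs2_horner_lb D0.
exists (K / k) => [|w]; first by rewrite divr_ge0// ltW.
have Q0 : 0 < 1 + w ^+ 2 by rewrite ltr_wpDr// sqr_ge0.
rewrite abs2_div ler_pdivrMr ?abs2_gt0//.
apply: (le_trans (XK w)); apply: le_trans (ler_wpM2l _ (kD w)).
  rewrite D2 [_ ^+ _.-2.+1]exprS; move: (_ ^+ _.-2) => v; rewrite [leRHS](_ : _ = K * v)//.
  by field; rewrite !gt_eqF.
by rewrite !divr_ge0// ltW.
Qed.

End ImaginaryAxis.

(** * Integrals over the real line by primitives *)

Section RealLineIntegral.
Variable R : realType.
Local Notation mu := (@lebesgue_measure R).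
Local Open Scope classical_set_scope.
Implicit Types (f F : R -> R).

Lemma is_derive_continuous F (x y : R) : is_derive x (1 : R) F y ->
  F t @[t --> x] --> F x.
Proof.
by move=> dF; apply: differentiable_continuous; exact/derivable1_diffP/ex_derive.
Qed.

(** The line is cut at 0 and the negative half reflected, so that the fundamental theorem on a
    half-line applies to both pieces. *)
Lemma ge0_integralT_FTC f F (l l' : R) :
  (forall x, 0 <= f x) -> continuous f ->
  (forall x, is_derive x (1 : R) F (f x)) ->
  F x @[x --> +oo] --> l -> F x @[x --> -oo] --> l' ->
  (\int[mu]_x (f x)%:E = (l - l')%:E)%E.
Proof.
move=> f0 cf dF Fl Fl'.
have mf : measurable_fun [set: R] f by exact: continuous_measurable_fun.
have dG x : is_derive x (1 : R) (fun x => - F (- x)) (f (- x)).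
  have dNF : is_derive x (1 : R) (F \o -%R) (f (- x) * (- 1)).
    by apply: is_derive1_comp.
  have -> : f (- x) = - (f (- x) * (- 1)) by ring.
  exact: is_deriveN dNF.
rewrite -(setUv `[0, +oo[%classic) ge0_integral_setU//=; last 4 first.
- exact: measurableC.
- by apply/measurable_EFinP; rewrite setUv.
- by move=> x _; rewrite lee_fin.
- exact/disj_setPCl.
rewrite (@ge0_continuous_FTC2y _ f F 0 l)//; last 3 first.
- exact: continuous_subspaceT.
- by apply: cvg_at_right_filter; exact: is_derive_continuous (dF 0).
- by move=> x _; rewrite derive1E; exact: derive_val.
rewrite setCitvr integral_itv_bndo_bndc; last first.
  exact/measurable_EFinP/measurable_funTS.
have -> : (\int[mu]_(x in `]-oo, 0%R]) (f x)%:E =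
    \int[mu]_(x in `[0%R, +oo[) ((f \o -%R) x)%:E)%E.
  have := @ge0_integration_by_substitutionNy _ f 0; rewrite oppr0; apply => //.
  exact: continuous_subspaceT.
rewrite (@ge0_continuous_FTC2y _ _ (fun x => - F (- x)) 0 (- l'))//=.
- by rewrite oppr0 -!EFinB -EFinD; congr EFin; ring.
- apply: continuous_subspaceT => x; apply: continuous_comp; first exact: opp_continuous.
  exact: cf.
- by apply: cvgN; exact/cvgNy_compNP.
- by apply: cvg_at_right_filter; exact: is_derive_continuous (dG 0).
- by move=> x _; rewrite derive1E; exact: derive_val.
Qed.

Lemma cvgNy_atan : (@atan R) x @[x --> -oo] --> - (pi / 2).
Proof.
apply/cvgNy_compNP; rewrite (_ : _ \o _ = fun x => - atan x); last first.
  by apply/funext => x /=; rewrite atanN.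
by apply: cvgN; exact: cvgy_atan.
Qed.

Lemma integralT_oneDsqrV : (\int[mu]_x (1 + x ^+ 2)^-1%:E = pi%:E)%E.
Proof.
rewrite (@ge0_integralT_FTC _ (@atan R) (pi / 2) (- (pi / 2))).
- by congr EFin; field.
- by move=> x; rewrite invr_ge0 addr_ge0// sqr_ge0.
- exact: continuous_oneDsqrV.
- exact: cvgy_atan.
- exact: cvgNy_atan.
Qed.

Lemma integrableT_oneDsqrV (K : R) :
  mu.-integrable setT (EFin \o (fun x => K / (1 + x ^+ 2))).
Proof.
have mV : measurable_fun [set: R] (fun x : R => (1 + x ^+ 2)^-1).
  by apply: continuous_measurable_fun; exact: continuous_oneDsqrV.
apply: (@integrableZl _ _ _ mu setT measurableT K (EFin \o fun x => (1 + x ^+ 2)^-1)).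
apply/integrableP; split; first exact/measurable_EFinP.
rewrite [ltLHS](_ : _ = pi%:E) ?ltry// -integralT_oneDsqrV.
apply: eq_integral => x _ /=; rewrite ger0_norm//.
by rewrite invr_ge0 addr_ge0// sqr_ge0.
Qed.

Lemma integrable_decay f K : continuous f ->
  (forall x, `|f x| <= K / (1 + x ^+ 2)) -> mu.-integrable setT (EFin \o f).
Proof.
move=> cf fK; apply: (le_integrable measurableT _ _ (integrableT_oneDsqrV K)).
  by apply/measurable_EFinP; exact: continuous_measurable_fun.
by move=> x _ /=; rewrite lee_fin (le_trans (fK x))// ler_norm.
Qed.

Lemma Rintegral_oneDsqrV (K : R) : \int[mu]_x (K / (1 + x ^+ 2)) = K * pi.
Proof.
have i1 := integrableT_oneDsqrV 1.
under eq_Rintegral do rewrite -[X in X / _]mulr1 -mulrA.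
by rewrite RintegralZl// /Rintegral; under eq_integral do rewrite mul1r; rewrite integralT_oneDsqrV.
Qed.

Lemma Rintegral_decay f K : continuous f ->
  (forall x, `|f x| <= K / (1 + x ^+ 2)) -> `|\int[mu]_x f x| <= K * pi.
Proof.
move=> cf fK; have fi := integrable_decay cf fK.
rewrite (le_trans (le_normr_Rintegral _ fi))// -Rintegral_oneDsqrV.
apply: le_Rintegral => //; last exact: integrableT_oneDsqrV.
rewrite (_ : EFin \o _ = abse \o (EFin \o f)); last exact/funext.
exact: integrable_abse.
Qed.

(** Adding K / (1 + x^2) makes the integrand nonnegative, with primitive F + K atan; the added mass
    K pi is then subtracted. *)
Lemma Rintegral_decay_FTC f F K : continuous f ->
  (forall x, `|f x| <= K / (1 + x ^+ 2)) ->
  (forall x, is_derive x (1 : R) F (f x)) ->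
  F x @[x --> +oo] --> (0 : R) -> F x @[x --> -oo] --> (0 : R) ->
  \int[mu]_x f x = 0.
Proof.
move=> cf fK dF Fy FNy; have fi := integrable_decay cf fK.
have gi := integrableT_oneDsqrV K.
have : \int[mu]_x (f x + K / (1 + x ^+ 2)) = K * pi.
  rewrite /Rintegral (@ge0_integralT_FTC _ (fun x => F x + K * atan x)
    (0 + K * (pi / 2)) (0 + K * (- (pi / 2))))/=.
  - by field.
  - move=> x; have := fK x; rewrite ler_norml => /andP[+ _]; lra.
  - move=> x; apply: cvgD; first exact: cf.
    by apply: cvgM; [exact: cvg_cst|exact: continuous_oneDsqrV].
  - by apply: cvgD => //; apply: cvgM; [exact: cvg_cst|exact: cvgy_atan].
  - by apply: cvgD => //; apply: cvgM; [exact: cvg_cst|exact: cvgNy_atan].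
by rewrite RintegralD// Rintegral_oneDsqrV; lra.
Qed.

End RealLineIntegral.

(** * Primitives, vanishing at both ends, of elementary stable functions *)

Section StablePrimitive.
Variable R : realType.
Local Notation C := R[i].
Local Open Scope complex_scope.
Local Open Scope classical_set_scope.
Implicit Types (f h F G : R -> C) (g : R -> R) (z : C).

Definition tends0 g : Prop :=
  (g x @[x --> +oo] --> (0 : R)) /\ (g x @[x --> -oo] --> (0 : R)).

Lemma tends0D g1 g2 : tends0 g1 -> tends0 g2 -> tends0 (fun x => g1 x + g2 x).
Proof.
by move=> [g1y g1Ny] [g2y g2Ny]; split; rewrite -[0 : R]addr0; apply: cvgD.
Qed.

Lemma tends0Z (c : R) g : tends0 g -> tends0 (fun x => c * g x).
Proof.
move=> [gy gNy]; split; rewrite -(mulr0 c); apply: cvgM => //; exact: cvg_cst.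
Qed.

Lemma tends0_sqr_decay g (K : R) :
  (forall w, g w ^+ 2 <= K / (1 + w ^+ 2)) -> tends0 g.
Proof.
move=> gK.
have K0 : 0 <= K.
  by have := le_trans (sqr_ge0 _) (gK 0); rewrite expr0n addr0 divr1.
(* Past this threshold |w| > 1, so w^2 >= |w| > K / eps^2. *)
have small eps w : 0 < eps -> 1 + K / eps ^+ 2 < `|w| -> `|g w| < eps.
  move=> e0 wK; have e2 : 0 < eps ^+ 2 by rewrite exprn_gt0.
  have Ke : 0 <= K / eps ^+ 2 by rewrite divr_ge0// ltW.
  rewrite -(@ltr_pXn2r _ 2)// ?nnegrE// ?(ltW e0)// real_normK ?num_real//.
  apply: (le_lt_trans (gK w)); rewrite ltr_pdivrMr; last first.
    by rewrite ltr_wpDr// sqr_ge0.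
  rewrite -ltr_pdivrMl// [_^-1 * _]mulrC.
  have : `|w| * `|w| = w ^+ 2 by rewrite -expr2 real_normK ?num_real.
  move: (K / _) wK Ke (normr_ge0 w) => k; nra.
split; apply/cvgr0Pnorm_lt => eps e0; near=> w; apply: small => //.
  by rewrite (lt_le_trans _ (ler_norm w))//; near: w; apply: nbhs_pinfty_gt; exact: num_real.
rewrite -normrN (lt_le_trans _ (ler_norm _))// ltrNr.
by near: w; apply: nbhs_ninfty_lt; exact: num_real.
Unshelve. all: end_near. Qed.

(** Derivative of a complex function of a real variable, taken componentwise so that the real rules
    apply. *)
Definition cderiv F f : Prop := forall w : R,
  is_derive w (1 : R) (fun t => complex.Re (F t)) (complex.Re (f w)) /\
  is_derive w (1 : R) (fun t => complex.Im (F t)) (complex.Im (f w)).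

Lemma cderiv_cst z : cderiv (fun=> z) (fun=> 0).
Proof. by move=> w; split; exact: is_derive_cst. Qed.

Lemma cderivD F f G h : cderiv F f -> cderiv G h ->
  cderiv (fun w => F w + G w) (fun w => f w + h w).
Proof.
move=> dF dG w; have [Fr Fi] := dF w; have [Gr Gi] := dG w.
split; rewrite (cReD, cImD).
  by under eq_fun do rewrite cReD; apply: is_deriveD.
by under eq_fun do rewrite cImD; apply: is_deriveD.
Qed.

Lemma cderivM F f G h : cderiv F f -> cderiv G h ->
  cderiv (fun w => F w * G w) (fun w => f w * G w + F w * h w).
Proof.
move=> dF dG w; have [Fr Fi] := dF w; have [Gr Gi] := dG w.
rewrite cReD cImD !cReM !cImM; split.
  under eq_fun do rewrite cReM.
  apply: (is_derive_eq (is_deriveB (is_deriveM Fr Gr) (is_deriveM Fi Gi))).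
  by rewrite /GRing.scale/=; ring.
under eq_fun do rewrite cImM.
apply: (is_derive_eq (is_deriveD (is_deriveM Fr Gi) (is_deriveM Fi Gr))).
by rewrite /GRing.scale/=; ring.
Qed.

(** The property that will force the integral of [f] over the line to vanish. It is stable under
    linear combinations, hence suited to partial fractions. *)
Definition primitive0 f : Prop := exists2 F, cderiv F f &
  tends0 (fun w => complex.Re (F w)) /\ tends0 (fun w => complex.Im (F w)).

Lemma primitive0D f h : primitive0 f -> primitive0 h ->
  primitive0 (fun w => f w + h w).
Proof.
move=> [F dF [Fr Fi]] [G dG [Gr Gi]]; exists (fun w => F w + G w).
  exact: cderivD.
split.
  by under eq_fun do rewrite cReD; exact: tends0D.
by under eq_fun do rewrite cImD; exact: tends0D.
Qed.

Lemma primitive0Z z f : primitive0 f -> primitive0 (fun w => z * f w).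
Proof.
move=> [F dF [Fr Fi]]; exists (fun w => z * F w).
  have := cderivM (cderiv_cst z) dF.
  by under [X in cderiv _ X -> _]eq_fun do rewrite mul0r add0r.
split.
  under eq_fun do rewrite cReM -mulNr; apply: tends0D; exact: tends0Z.
by under eq_fun do rewrite cImM; apply: tends0D; exact: tends0Z.
Qed.

Lemma abs2_tends0 F (K : R) : (forall w, abs2 (F w) <= K / (1 + w ^+ 2)) ->
  tends0 (fun w => complex.Re (F w)) /\ tends0 (fun w => complex.Im (F w)).
Proof.
move=> FK; split; apply: (@tends0_sqr_decay _ K) => w.
  by rewrite (le_trans _ (FK w))// /abs2 lerDl sqr_ge0.
by rewrite (le_trans _ (FK w))// /abs2 lerDr sqr_ge0.
Qed.

Lemma jwB_neq0 z (w : R) : complex.Re z < 0 -> jw w - z != 0.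
Proof.
move=> z0; rewrite subr_eq0; apply: contraTneq z0 => <-.
by rewrite jwE/= ltxx.
Qed.

Lemma jwBE z (w : R) :
  jw w - z = (- complex.Re z) +i* (w - complex.Im z).
Proof. by case: z => p q; rewrite jwE; simpc. Qed.

Lemma Re_jwB z (w : R) : complex.Re (jw w - z) = - complex.Re z.
Proof. by rewrite jwBE. Qed.

Lemma Im_jwB z (w : R) : complex.Im (jw w - z) = w - complex.Im z.
Proof. by rewrite jwBE. Qed.

Lemma abs2_jwBE z (w : R) :
  abs2 (jw w - z) = complex.Re z ^+ 2 + (w - complex.Im z) ^+ 2.
Proof. by rewrite jwBE /abs2/= sqrrN. Qed.

Lemma abs2_jwB_gt0 z (w : R) : complex.Re z < 0 -> 0 < abs2 (jw w - z).
Proof. by move=> z0; rewrite abs2_gt0 jwB_neq0. Qed.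

Lemma is_derive_subr (q w : R) : is_derive w (1 : R) (fun t => t - q) 1.
Proof.
by apply: (is_derive_eq (is_deriveB (is_derive_id _ _) (is_derive_cst q _ _))); rewrite subr0.
Qed.

Lemma is_derive_abs2_jwB z (w : R) :
  is_derive w (1 : R) (fun t => abs2 (jw t - z)) (2 * (w - complex.Im z)).
Proof.
under eq_fun do rewrite abs2_jwBE.
have d1 := is_derive_subr (complex.Im z) w.
apply: (is_derive_eq (is_deriveD (is_derive_cst (complex.Re z ^+ 2) w 1) (is_deriveX 2 d1))).
by rewrite /GRing.scale/= expr1; ring.
Qed.

Lemma cderiv_jwBV z : complex.Re z < 0 ->
  cderiv (fun w => (jw w - z)^-1) (fun w => - 'i * (jw w - z) ^- 2).
Proof.
move=> z0 w.
have A0 : abs2 (jw w - z) != 0 by rewrite gt_eqF ?abs2_jwB_gt0.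
have dA := @is_deriveV _ (fun t => abs2 (jw t - z)) _ _ _ A0 (is_derive_abs2_jwB z w).
rewrite cReM cImM -exprVn expr2 cReM cImM cReV cImV.
have A1 := A0; rewrite abs2_jwBE in A1; split.
  under eq_fun do rewrite cReV Re_jwB.
  apply: (is_derive_eq (is_deriveM (is_derive_cst (- complex.Re z) w 1) dA)).
  rewrite /GRing.scale/= Re_jwB Im_jwB abs2_jwBE; field.
  by [].
under eq_fun do rewrite cImV Im_jwB.
apply: (is_derive_eq (is_deriveN (is_deriveM (is_derive_subr (complex.Im z) w) dA))).
rewrite /GRing.scale/= Re_jwB Im_jwB abs2_jwBE; field.
by [].
Qed.

(** From exponent 2 on, the primitive is a constant times the next lower power, which still vanishes
    at infinity. *)
Lemma primitive0_pole z k : complex.Re z < 0 ->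
  primitive0 (fun w => (jw w - z)^-1 ^+ k.+2).
Proof.
move=> z0.
have dk n : cderiv (fun w => (jw w - z)^-1 ^+ n.+1)
   (fun w => - 'i * n.+1%:R * (jw w - z)^-1 ^+ n.+2).
  elim: n => [|n IH].
    have := cderiv_jwBV z0.
    by under [X in _ -> cderiv _ X]eq_fun do rewrite mulr1 exprVn.
  have := cderivM (cderiv_jwBV z0) IH.
  under eq_fun do rewrite -exprS.
  congr cderiv; apply/funext => w; rewrite -exprVn [n.+2%:R]mulrS !exprS; ring.
have [c cP] : exists c : C, c * (- 'i * k.+1%:R) = 1.
  exists (- 'i * k.+1%:R)^-1; rewrite mulVf// mulf_neq0// ?pnatr_eq0//.
  by rewrite oppr_eq0 eq_complex/= oner_eq0 andbF.
exists (fun w => c * (jw w - z)^-1 ^+ k.+1).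
  have := cderivM (cderiv_cst c) (dk k).
  by under [X in cderiv _ X -> _]eq_fun do rewrite mul0r add0r mulrA cP mul1r.
have [|w|K _ FK] := @abs2_ratio_decay R c%:P (('X - z%:P) ^+ k.+1).
- by rewrite size_exp_XsubC (leq_ltn_trans (size_polyC_leq1 _)).
- by rewrite horner_exp hornerXsubC expf_neq0// jwB_neq0.
apply: (@abs2_tends0 _ K) => w; have := FK w.
by rewrite hornerC horner_exp hornerXsubC exprVn.
Qed.

Lemma tends0M g1 g2 : tends0 g1 -> tends0 g2 -> tends0 (fun x => g1 x * g2 x).
Proof.
by move=> [g1y g1Ny] [g2y g2Ny]; split; rewrite -[0 : R](mulr0 0); apply: cvgM.
Qed.

Lemma tends0_ln1D g : tends0 g -> tends0 (fun x => ln (1 + g x)).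
Proof.
move=> [gy gNy]; rewrite /tends0 -(@ln1 R).
split; (apply: continuous_cvg; first exact: continuous_ln);
  by rewrite -[X in _ --> X]addr0; apply: cvgD => //; exact: cvg_cst.
Qed.

(** For P > 0 both arctangents have the same limit at each end. With P = - Re z this is where
    stability of the pole z enters. *)
Lemma tends0_atan_diff (q P : R) : 0 < P ->
  tends0 (fun w => atan ((w - q) / P) - atan w).
Proof.
move=> P0; split.
  rewrite -(subrr (pi / 2 : R)); apply: cvgB; last exact: cvgy_atan.
  apply: (cvg_comp (fun w => (w - q) / P) (@atan R) _ (@cvgy_atan R)); apply/cvgryPgt => A.
  near=> w; rewrite ltr_pdivlMr// ltrBrDr.
  by near: w; apply: nbhs_pinfty_gt; exact: num_real.
rewrite -(subrr (- (pi / 2) : R)); apply: cvgB; last exact: cvgNy_atan.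
apply: (cvg_comp (fun w => (w - q) / P) (@atan R) _ (@cvgNy_atan R)); apply/cvgrNyPlt => A.
near=> w; rewrite ltr_pdivrMr// ltrBlDr.
by near: w; apply: nbhs_ninfty_lt; exact: num_real.
Unshelve. all: end_near. Qed.

(** The primitive is -i log(iw - z) for the principal logarithm: iw - z has positive real part, so
    its argument is an arctangent. *)
Lemma cderiv_log z : complex.Re z < 0 ->
  cderiv (fun w => (atan ((w - complex.Im z) / (- complex.Re z)))
                   +i* (- (2^-1 * ln (abs2 (jw w - z)))))
         (fun w => (jw w - z)^-1).
Proof.
move=> z0 w; have A0 := abs2_jwB_gt0 w z0.
rewrite cReV cImV Re_jwB Im_jwB; split => /=.
  have d1 := is_deriveM (is_derive_subr (complex.Im z) w)
                        (is_derive_cst (- complex.Re z)^-1 w 1).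
  have d2 := is_derive1_atan ((w - complex.Im z) / (- complex.Re z)).
  apply: (is_derive_eq (@is_derive1_comp _ (@atan R)
    (fun t => (t - complex.Im z) / (- complex.Re z)) w _ _ d2 d1)).
  move: A0; rewrite abs2_jwBE => A0; rewrite /GRing.scale/=.
  by field; rewrite (lt_eqF z0) (gt_eqF A0).
apply: (is_derive_eq (is_deriveN (is_deriveZ 2^-1
  (@is_derive1_comp _ (@ln R) (fun t => abs2 (jw t - z)) w _ _
    (is_derive1_ln A0) (is_derive_abs2_jwB z w))))).
by rewrite /GRing.scale/=; field; rewrite gt_eqF.
Qed.

(** The logarithm of a single pole does not vanish at both ends, but for two poles on the same side
    of the axis the arguments and the log-moduli cancel in the limit. *)
Lemma primitive0_two_poles z1 z2 : complex.Re z1 < 0 -> complex.Re z2 < 0 ->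
  primitive0 (fun w => (jw w - z1)^-1 - (jw w - z2)^-1).
Proof.
move=> z10 z20.
have := cderivM (cderiv_cst (- 1)) (cderiv_log z20).
under [X in cderiv _ X -> _]eq_fun do rewrite mul0r add0r mulN1r.
move/(cderivD (cderiv_log z10)) => d12; eexists; first exact: d12.
split.
  under eq_fun do rewrite mulN1r/=.
  have := tends0D (tends0_atan_diff (complex.Im z1) (P := - complex.Re z1) _)
    (tends0Z (- 1) (tends0_atan_diff (complex.Im z2) (P := - complex.Re z2) _)).
  rewrite !oppr_gt0 => /(_ z10 z20); congr tends0; apply/funext => w /=; ring.
(* (iw - z1) / (iw - z2) = 1 + eps with eps tending to 0, and the difference of log-moduli is half
   of ln (1 + 2 Re eps + |eps|^2). *)
pose eps w := (z2 - z1) / (jw w - z2).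
have [|w|K _ FK] := @abs2_ratio_decay R (z2 - z1)%:P ('X - z2%:P).
- by rewrite size_XsubC (leq_ltn_trans (size_polyC_leq1 _)).
- by rewrite hornerXsubC jwB_neq0.
have [|er ei] := @abs2_tends0 eps K.
  by move=> w; have := FK w; rewrite hornerC hornerXsubC.
have := tends0D (tends0Z 2 er) (tends0D (tends0M er er) (tends0M ei ei)).
move/tends0_ln1D/(tends0Z (- 2^-1)); congr tends0; apply/funext => w.
rewrite mulN1r/= opprK -[_ + _ * ln (abs2 _)]opprK opprD opprK -mulrBr mulNr.
congr (- (_ * _)); rewrite -ln_div ?posrE ?abs2_jwB_gt0//; congr ln.
rewrite -abs2_div; have -> : (jw w - z1) / (jw w - z2) = 1 + eps w.
  by rewrite /eps; field; rewrite jwB_neq0.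
by rewrite abs2D /dotc {1}/abs2/= /abs2; ring.
Qed.

End StablePrimitive.

(** * Vanishing integrals of stable rational functions *)

Section StableIntegral.
Variable R : realType.
Local Notation C := R[i].
Local Open Scope complex_scope.
Implicit Types (r : seq C) (X D : {poly C}).

Let stable r := {in r, forall z, complex.Re z < 0}.

(** Partial fractions, one pair of distinct poles at a time; the only products
    which cannot be shortened are powers of a single pole and pairs of poles. *)
Lemma primitive0_prodV r : stable r -> (1 < size r)%N ->
  primitive0 (fun w => \prod_(z <- r) (jw w - z)^-1).
Proof.
have [n] := ubnP (size r); elim: n r => // n IH [//|z1 r] rn rs r1.
have z10 : complex.Re z1 < 0 by rewrite rs// mem_head.
have [/all_pred1P r_eq|] := boolP (all (pred1 z1) r).
  move: r1; rewrite /= ltnS => /prednK r1.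
  have := primitive0_pole (size r).-1 z10; rewrite r1.
  congr primitive0; apply/funext => w.
  by rewrite big_cons [in RHS]r_eq big_nseq iter_mulr_1 exprS.
case/allPn => z2 z2r z12; have z20 : complex.Re z2 < 0.
  by rewrite rs// inE z2r orbT.
have prem := perm_to_rem z2r; set t := rem z2 r in prem.
have st : {subset t <= r} by exact: mem_rem.
have diff w : \prod_(z <- z1 :: r) (jw w - z)^-1 = (z1 - z2)^-1 *
    (\prod_(z <- z1 :: t) (jw w - z)^-1 + (- 1) * \prod_(z <- z2 :: t) (jw w - z)^-1).
  have er : \prod_(z <- r) (jw w - z)^-1 =
      (jw w - z2)^-1 * \prod_(z <- t) (jw w - z)^-1.
    by rewrite (perm_big _ prem) big_cons.
  rewrite !big_cons er; field.
  by rewrite !jwB_neq0// subr_eq0 eq_sym.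
suff : primitive0 (fun w => (z1 - z2)^-1 * (\prod_(z <- z1 :: t) (jw w - z)^-1 +
    (- 1) * \prod_(z <- z2 :: t) (jw w - z)^-1)).
  by congr primitive0; apply/funext => w; rewrite diff.
apply: primitive0Z.
have str : size r = (size t).+1 by rewrite (perm_size prem).
(* Without further poles the two products are single simple poles, which have a suitable primitive
   only jointly. *)
have [t0|t0] := posnP (size t).
  have := primitive0_two_poles z10 z20; congr primitive0; apply/funext => w.
  by rewrite (size0nil t0) !big_cons !big_nil !mulr1 mulN1r.
have IHt z : complex.Re z < 0 ->
    primitive0 (fun w => \prod_(x <- z :: t) (jw w - x)^-1).
  move=> z0; apply: IH => //=; first by rewrite -str; exact: rn.
  by move=> x; rewrite inE => /predU1P[->//|/st xr]; rewrite rs// inE xr orbT.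
by apply: primitive0D (IHt _ z10) _; apply: primitive0Z (IHt _ z20).
Qed.

(** Euclidean division by s - z splits off a constant numerator over at least two poles; in the
    other summand one pole cancels, and induction on the poles applies. *)
Lemma primitive0_stable r X : stable r -> (size X < size r)%N ->
  primitive0 (fun w => X.[jw w] * \prod_(z <- r) (jw w - z)^-1).
Proof.
have [->|X0] := eqVneq X 0.
  move=> _ _; exists (fun=> 0).
    by under [X in cderiv _ X]eq_fun do rewrite horner0 mul0r; exact: cderiv_cst.
  by split; apply: (@tends0_sqr_decay _ _ 0) => w; rewrite expr0n mul0r.
elim: r X X0 => // z r IH X X0 rs /=; rewrite ltnS => Xr.
have z0 : complex.Re z < 0 by rewrite rs// mem_head.
have r1 : (1 < size (z :: r))%N.
  by rewrite /= ltnS (leq_trans _ Xr)// size_poly_gt0.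
pose Y := X %/ ('X - z%:P).
have XE : X = Y * ('X - z%:P) + X.[z]%:P by rewrite -modp_XsubC -divp_eq.
have -> : (fun w => X.[jw w] * \prod_(x <- z :: r) (jw w - x)^-1) =
    (fun w => Y.[jw w] * \prod_(x <- r) (jw w - x)^-1 +
              X.[z] * \prod_(x <- z :: r) (jw w - x)^-1).
  apply/funext => w; rewrite {1}XE hornerD hornerM hornerXsubC hornerC big_cons.
  by field; rewrite jwB_neq0.
apply: primitive0D; last by apply/primitive0Z/primitive0_prodV.
have [->|Y0] := eqVneq Y 0; last first.
  apply: IH => // [x xr|]; first by rewrite rs// inE xr orbT.
  by rewrite size_divp ?polyXsubC_eq0// size_XsubC subn1 prednK// size_poly_gt0.
exists (fun=> 0).
  by under [X in cderiv _ X]eq_fun do rewrite horner0 mul0r; exact: cderiv_cst.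
by split; apply: (@tends0_sqr_decay _ _ 0) => w; rewrite expr0n mul0r.
Qed.

(** An elementary form of Cauchy's theorem for the right half plane: no contour is closed, since a
    primitive vanishing at both ends gives the value 0. *)
Lemma Rintegral_stable X D (K : R) :
  (forall z, root D z -> complex.Re z < 0) -> (size X + 2 <= size D)%N ->
  (forall w, `|complex.Re (X.[jw w] / D.[jw w])| <= K / (1 + w ^+ 2)) ->
  \int[@lebesgue_measure R]_w complex.Re (X.[jw w] / D.[jw w]) = 0.
Proof.
move=> Ds XD XK.
have D0 : D != 0 by rewrite -size_poly_gt0 (leq_trans _ XD)// addn2.
have Djw w : D.[jw w] != 0.
  by apply/negP => /Ds; rewrite jwE/= ltxx.
have [r Dr] := closed_field_poly_normal D.
have l0 : lead_coef D != 0 by rewrite lead_coef_eq0.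
have rs : stable r.
  by move=> z zr; apply: Ds; rewrite Dr rootZ// root_prod_XsubC.
have Xr : (size ((lead_coef D)^-1 *: X)%R < size r)%N.
  rewrite (leq_ltn_trans (size_scale_leq _ _))//.
  by move: XD; rewrite Dr size_scale// size_prod_XsubC addn2 ltnS.
have [F dF [[Fry FrNy] _]] := primitive0_stable rs Xr.
have [cf _] := ccont_ratio X Djw.
apply: (Rintegral_decay_FTC cf XK _ Fry FrNy) => w; have [+ _] := dF w.
congr is_derive; congr complex.Re.
rewrite [in RHS]Dr !hornerZ horner_prod.
under [in RHS]eq_bigr do rewrite hornerXsubC.
by rewrite prodfV invfM; ring.
Qed.

End StableIntegral.

(** * First variation of the squared H2 norm *)

Section FirstVariation.
Variable R : realType.
Local Notation C := R[i].
Local Notation mu := (@lebesgue_measure R).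
Local Open Scope complex_scope.
Local Open Scope classical_set_scope.
Implicit Types (a b c d e p q u v : {poly R}) (w t : R).

Definition ev p w : C := (polC p).[jw w].

Lemma evD p q w : ev (p + q) w = ev p w + ev q w.
Proof. by rewrite /ev /polC rmorphD hornerD. Qed.

Lemma evB p q w : ev (p - q) w = ev p w - ev q w.
Proof. by rewrite /ev /polC rmorphB hornerD hornerN. Qed.

Lemma evM p q w : ev (p * q) w = ev p w * ev q w.
Proof. by rewrite /ev /polC rmorphM hornerM. Qed.

Lemma evZ t p w : ev (t *: p) w = t%:C * ev p w.
Proof. by rewrite /ev /polC map_polyZ hornerZ. Qed.

Lemma evX p n w : ev (p ^+ n) w = ev p w ^+ n.
Proof. by rewrite /ev /polC rmorphXn horner_exp. Qed.

Lemma size_polC p : size (polC p) = size p.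
Proof. exact: size_map_poly. Qed.

Lemma ev_neq0 a w : hurwitz a -> ev a w != 0.
Proof. by move=> ha; apply/negP => /ha; rewrite jwE/= ltxx. Qed.

Lemma ccont_ev p q : (forall w, ev q w != 0) -> ccont (fun w => ev p w / ev q w).
Proof. exact: ccont_ratio. Qed.

Lemma abs2_ev_decay p q : (size p < size q)%N -> (forall w, ev q w != 0) ->
  exists2 K : R, 0 <= K & forall w, abs2 (ev p w / ev q w) <= K / (1 + w ^+ 2).
Proof. by move=> pq q0; apply: abs2_ratio_decay => //; rewrite !size_polC. Qed.

Lemma integrable_abs2_ev p q : (size p < size q)%N -> (forall w, ev q w != 0) ->
  mu.-integrable setT (EFin \o fun w => abs2 (ev p w / ev q w)).
Proof.
move=> pq q0; have [K _ qK] := abs2_ev_decay pq q0.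
apply: (@integrable_decay _ _ K); first exact/continuous_abs2/ccont_ev.
by move=> w; rewrite ger0_norm// abs2_ge0.
Qed.

Lemma dotc_decay p1 q1 p2 q2 : (size p1 < size q1)%N -> (forall w, ev q1 w != 0) ->
  (size p2 < size q2)%N -> (forall w, ev q2 w != 0) ->
  exists2 K : R, 0 <= K & forall w,
    `|2 * dotc (ev p1 w / ev q1 w) (ev p2 w / ev q2 w)| <= K / (1 + w ^+ 2).
Proof.
move=> pq1 q10 pq2 q20.
have [K1 K10 qK1] := abs2_ev_decay pq1 q10.
have [K2 K20 qK2] := abs2_ev_decay pq2 q20.
exists (K1 + K2) => [|w]; first exact: addr_ge0.
by rewrite [leRHS]mulrDl (le_trans (dotc_le _ _))// lerD.
Qed.

Lemma integrable_dotc_ev p1 q1 p2 q2 :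
  (size p1 < size q1)%N -> (forall w, ev q1 w != 0) ->
  (size p2 < size q2)%N -> (forall w, ev q2 w != 0) ->
  mu.-integrable setT
    (EFin \o fun w => 2 * dotc (ev p1 w / ev q1 w) (ev p2 w / ev q2 w)).
Proof.
move=> pq1 q10 pq2 q20; have [K _ qK] := dotc_decay pq1 q10 pq2 q20.
apply: (@integrable_decay _ _ K) => // w.
apply: cvgM; first exact: cvg_cst.
by apply: continuous_dotc; exact: ccont_ev.
Qed.

Lemma dotc_combr (z z1 z2 : C) t :
  dotc z (z1 - t%:C * z2) = dotc z z1 - t * dotc z z2.
Proof. by case: z z1 z2 => x y [x1 y1] [x2 y2]; rewrite /dotc/=; ring. Qed.

Lemma dotcZr (z z1 : C) t : dotc z (t%:C * z1) = t * dotc z z1.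
Proof. by case: z z1 => x y [x1 y1]; rewrite /dotc/=; ring. Qed.

(** Writing the difference of the two errors as [t * g], only algebra is needed:
    [g - c / A ^ 2] is again a multiple of [t]. *)
Lemma error_expansion (A B D E U V : C) t :
  A != 0 -> D != 0 -> A + t%:C * U != 0 ->
  let h := (E * A - B * D) / (D * A) in
  let c := B * U - V * A in
  `|abs2 ((E * (A + t%:C * U) - (B + t%:C * V) * D) / (D * (A + t%:C * U)))
    - abs2 h - t * (2 * dotc h (c / A ^+ 2))|
  <= t ^+ 2 * (abs2 (c / (A * (A + t%:C * U))) + abs2 h
               + abs2 (c * U / (A ^+ 2 * (A + t%:C * U)))).
Proof.
move=> A0 D0 At0; cbv zeta; set h := (_ - _) / (D * A); set c := _ - V * A.
set g := c / (A * (A + t%:C * U)); set k := c * U / (A ^+ 2 * (A + t%:C * U)).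
have -> : (E * (A + t%:C * U) - (B + t%:C * V) * D) / (D * (A + t%:C * U)) =
    h + t%:C * g by rewrite /h /g /c; field; rewrite At0 A0 D0.
have -> : c / A ^+ 2 = g - (- t)%:C * k.
  by rewrite rmorphN/= /g /k; field; rewrite At0 A0.
rewrite abs2D dotcZr dotc_combr abs2M abs2_real.
rewrite [X in `|X|](_ : _ = t ^+ 2 * (abs2 g - 2 * dotc h k)); last by ring.
rewrite normrM (ger0_norm (sqr_ge0 t)) ler_wpM2l ?sqr_ge0//.
rewrite (le_trans (ler_normB _ _))// -addrA lerD ?dotc_le//.
by rewrite ger0_norm// abs2_ge0.
Qed.

(** If |t U| is at most |A| / 2, then |A + t U| is at least |A| / 2; the constants are the
    squares. *)
Lemma abs2_perturb (A U : C) (t K : R) : abs2 U <= K * abs2 A ->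
  t ^+ 2 * K <= 4^-1 -> abs2 A <= 4 * abs2 (A + t%:C * U).
Proof.
move=> UA tK.
have : abs2 A <= 2 * abs2 (A + t%:C * U) + 2 * (t ^+ 2 * abs2 U).
  have {1}-> : A = (A + t%:C * U) + (- t%:C * U) by ring.
  by rewrite (le_trans (abs2D_le _ _))// abs2M -rmorphN/= abs2_real sqrrN.
have := abs2_ge0 A; have : t ^+ 2 * abs2 U <= 4^-1 * abs2 A.
  rewrite (le_trans (ler_wpM2l (sqr_ge0 t) UA))// mulrA ler_wpM2r//.
  exact: abs2_ge0.
lra.
Qed.

Lemma size_mul_lt p1 q1 p2 q2 : (size p1 < size q1)%N ->
  (size p2 <= size q2)%N -> (0 < size q2)%N -> (size (p1 * p2)%R < size (q1 * q2)%R)%N.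
Proof.
move=> pq1 pq2 q20; have q10 : (0 < size q1)%N by rewrite (leq_ltn_trans _ pq1).
rewrite (leq_ltn_trans (size_polyMleq _ _))// size_mul -?size_poly_gt0//.
case: (size q1) pq1 q10 => // m pq1 _; case: (size q2) pq2 q20 => // k pq2 _.
rewrite addSn addnS/= ltnS; rewrite ltnS in pq1.
by have := leq_add pq1 pq2; rewrite addnS; case: (_ + _)%N.
Qed.

Lemma size_subr_lt p q n : (size p < n)%N -> (size q < n)%N -> (size (p - q)%R < n)%N.
Proof.
by move=> pn qn; rewrite (leq_ltn_trans (size_polyD _ _))// gtn_max size_polyN pn qn.
Qed.

Lemma H2sqE p q :
  H2sq p q = (2 * pi)^-1 * \int[mu]_w abs2 (ev p w / ev q w).
Proof. by congr *%R; apply: eq_Rintegral => w _; rewrite abs2_div. Qed.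

Lemma abs2_div_perturb (x y A At : C) : A != 0 -> At != 0 ->
  abs2 A <= 4 * abs2 At -> abs2 (x / (y * At)) <= 4 * abs2 (x / (y * A)).
Proof.
move=> A0 At0 AAt; rewrite !abs2_div !abs2M !invfM !mulrA.
rewrite [leRHS](_ : _ = abs2 x * (abs2 y)^-1 * (4 * (abs2 A)^-1)); last by ring.
rewrite ler_wpM2l ?mulr_ge0 ?invr_ge0 ?abs2_ge0//.
by rewrite ler_pdivlMr ?abs2_gt0// mulrC ler_pdivrMr ?abs2_gt0.
Qed.

(** Integrates [error_expansion] over the axis. The pointwise remainder is dominated by t^2 Kr / (1
    + w^2) uniformly in small t, so no differentiation under the integral sign is involved. *)
Lemma H2sq_expansion a b d e u v :
  hurwitz a -> hurwitz d -> (size b < size a)%N -> (size e < size d)%N ->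
  (size u < size a)%N -> (size v < size a)%N ->
  exists2 r : R, 0 < r & exists K : R, forall t, `|t| < r ->
   `|H2sq (e * (a + t *: u) - (b + t *: v) * d) (d * (a + t *: u))
     - H2sq (e * a - b * d) (d * a)
     - t * ((2 * pi)^-1 * \int[mu]_w (2 *
         dotc (ev (e * a - b * d) w / ev (d * a) w)
              (ev (b * u - v * a) w / ev (a ^+ 2) w)))|
   <= t ^+ 2 * K.
Proof.
move=> ha hd ba ed ua va.
have a0 : (0 < size a)%N by rewrite (leq_ltn_trans _ ba).
have d0 : (0 < size d)%N by rewrite (leq_ltn_trans _ ed).
have eva w : ev a w != 0 := ev_neq0 w ha.
have evd w : ev d w != 0 := ev_neq0 w hd.
have evda w : ev (d * a) w != 0 by rewrite evM mulf_neq0.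
have eva2 w : ev (a ^+ 2) w != 0 by rewrite expr2 evM mulf_neq0.
have eva3 w : ev (a ^+ 2 * a) w != 0 by rewrite evM mulf_neq0.
set p := e * a - b * d; set c := b * u - v * a.
have sp : (size p < size (d * a)%R)%N.
  by apply: size_subr_lt; last rewrite [d * a]mulrC; exact: size_mul_lt.
have sc : (size c < size (a ^+ 2)%R)%N.
  by rewrite expr2; apply: size_subr_lt; apply: size_mul_lt => //; exact: ltnW.
have scu : (size (c * u)%R < size (a ^+ 2 * a)%R)%N.
  by apply: size_mul_lt => //; exact: ltnW.
have [Kh Kh0 hK] := abs2_ev_decay sp evda.
have [Kc Kc0 cK] := abs2_ev_decay sc eva2.
have [Kk Kk0 kK] := abs2_ev_decay scu eva3.
have [Ku Ku0 uK] := abs2_ev_decay ua eva.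
have uKa w : abs2 (ev u w) <= Ku * abs2 (ev a w).
  rewrite -ler_pdivrMr ?abs2_gt0// -abs2_div (le_trans (uK w))//.
  by rewrite ler_pdivrMr ?ltr_wpDr ?sqr_ge0// ler_peMr// lerDl sqr_ge0.
(* This radius yields t^2 Ku <= 1/4, as [abs2_perturb] requires, and is defined even if Ku = 0. *)
exists (2 * (1 + Ku))^-1; first by rewrite invr_gt0 mulr_gt0// ltr_wpDr.
(* One summand for each remainder term of [error_expansion]; the factors 4 pay for replacing
   [a + t *: u] by [a] in a denominator, and pi is the integral of 1 / (1 + w^2). *)
pose Kr := 4 * Kc + Kh + 4 * Kk; exists ((2 * pi)^-1 * (Kr * pi)) => t.
rewrite -[_^-1]mul1r ltr_pdivlMr; last by rewrite mulr_gt0// ltr_wpDr.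
move=> tr; have tKu : t ^+ 2 * Ku <= 4^-1.
  have : t ^+ 2 = `|t| * `|t| by rewrite -expr2 real_normK ?num_real.
  have : (`|t| * (2 * (1 + Ku))) * (`|t| * (2 * (1 + Ku))) <= 1 * 1.
    by rewrite ler_pM ?mulr_ge0 ?addr_ge0// ltW.
  move: (normr_ge0 t); move: `|t| => s s0 sK ->; have := mulr_ge0 s0 s0; nra.
have aat w : abs2 (ev a w) <= 4 * abs2 (ev a w + t%:C * ev u w).
  exact: (abs2_perturb (uKa w)).
have at0 w : ev a w + t%:C * ev u w != 0.
  rewrite -abs2_gt0 -(pmulr_rgt0 _ (_ : 0 < 4))// (lt_le_trans _ (aat w))//.
  by rewrite abs2_gt0.
have evat w : ev (a + t *: u) w = ev a w + t%:C * ev u w by rewrite evD evZ.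
have sat : size (a + t *: u) = size a.
  by rewrite size_polyDl// (leq_ltn_trans (size_scale_leq _ _)).
set pt := e * (a + t *: u) - (b + t *: v) * d; set qt := d * (a + t *: u).
have evqt w : ev qt w != 0 by rewrite evM evat mulf_neq0.
have spt : (size pt < size qt)%N.
  apply: size_subr_lt; first by apply: size_mul_lt; rewrite // sat.
  rewrite /qt [d * _]mulrC; apply: size_mul_lt => //.
  rewrite sat (leq_ltn_trans (size_polyD _ _))// gtn_max ba/=.
  by rewrite (leq_ltn_trans (size_scale_leq _ _)).
pose ht w := abs2 (ev pt w / ev qt w); pose h0 w := abs2 (ev p w / ev (d * a) w).
pose g0 w := 2 * dotc (ev p w / ev (d * a) w) (ev c w / ev (a ^+ 2) w).
have remK w : `|ht w - h0 w - t * g0 w| <= t ^+ 2 * Kr / (1 + w ^+ 2).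
  have := error_expansion (ev b w) (ev e w) (ev v w) (eva w) (evd w) (at0 w).
  rewrite /ht /h0 /g0 /pt /qt /p /c !(evB, evM, evD, evZ, evX).
  move/le_trans; apply; rewrite -[leRHS]mulrA ler_wpM2l ?sqr_ge0//.
  have gK : abs2 ((ev b w * ev u w - ev v w * ev a w) /
      (ev a w * (ev a w + t%:C * ev u w))) <= 4 * Kc / (1 + w ^+ 2).
    rewrite (le_trans (abs2_div_perturb _ _ (eva w) (at0 w) (aat w)))// -[leRHS]mulrA.
    by rewrite ler_pM2l// -expr2; have := cK w; rewrite !(evB, evM, evX).
  rewrite /Kr [leRHS]mulrDl; apply: lerD.
    rewrite [leRHS]mulrDl; apply: lerD gK _.
    by have := hK w; rewrite !(evB, evM).
  rewrite (le_trans (abs2_div_perturb _ _ (eva w) (at0 w) (aat w)))// -[leRHS]mulrA.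
  by rewrite ler_pM2l//; have := kK w; rewrite !(evB, evM, evX).
have iht : mu.-integrable setT (EFin \o ht) by exact: integrable_abs2_ev.
have ih0 : mu.-integrable setT (EFin \o h0) by exact: integrable_abs2_ev.
have ig0 : mu.-integrable setT (EFin \o g0) by exact: integrable_dotc_ev.
have itg0 : mu.-integrable setT (EFin \o fun w => t * g0 w).
  exact: (@integrableZl _ _ _ mu setT measurableT t (EFin \o g0)).
have ihh : mu.-integrable setT (EFin \o fun w => ht w - h0 w).
  exact: (@integrableB _ _ _ mu setT measurableT (EFin \o ht) (EFin \o h0)).
have cr : continuous (fun w => ht w - h0 w - t * g0 w).
  move=> x; apply: cvgB.
    by apply: cvgB; apply: continuous_abs2; exact: ccont_ev.
  apply: cvgM; first exact: cvg_cst.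
  apply: cvgM; first exact: cvg_cst.
  by apply: continuous_dotc; exact: ccont_ev.
have := Rintegral_decay cr remK.
rewrite RintegralB// RintegralB// RintegralZl// !H2sqE => Ir.
rewrite [X in `|X|](_ : _ = (2 * pi)^-1 * (\int[mu]_w ht w - \int[mu]_w h0 w -
   t * \int[mu]_w g0 w)); last by ring.
have pi2 : 0 <= (2 * pi)^-1 :> R by rewrite invr_ge0 mulr_ge0// pi_ge0.
rewrite normrM ger0_norm// mulrCA ler_wpM2l//.
by rewrite (le_trans Ir)// -mulrA.
Qed.

Lemma quadratic_remainder_derive0 (g : R -> R) (k K r : R) : 0 < r ->
  (forall t, `|t| < r -> `|g t - g 0 - t * k| <= t ^+ 2 * K) ->
  t^-1 * (g t - g 0) @[t --> 0^'] --> (0 : R) -> k = 0.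
Proof.
move=> r0 gK g0; apply/eqP; apply: contraT => k0.
(* [K] has no prescribed sign and may be 0; [|K| + 1] is a positive substitute. *)
have K0 : 0 < `|K| + 1 by rewrite ltr_wpDl.
have k2 : 0 < `|k| / 2 by rewrite divr_gt0// normr_gt0.
suff : \forall t \near (0 : R)^', False by move/filter_ex => [].
move/cvgr0Pnorm_lt : g0 => /(_ _ k2) g0.
near=> t.
have t0 : t != 0 by near: t; exact: nbhs_dnbhs_neq.
have tr : `|t| < r.
  by near: t; apply: dnbhs0_lt.
have tk : `|t| < `|k| / 2 / (`|K| + 1).
  by near: t; apply: dnbhs0_lt; rewrite divr_gt0.
have gt : `|t^-1 * (g t - g 0)| < `|k| / 2 by near: t; exact: g0.
have : `|t^-1 * (g t - g 0) - k| <= `|t| * (`|K| + 1).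
  rewrite -(ler_pM2l (_ : 0 < `|t|)) ?normr_gt0// -normrM mulrBr mulVKf//.
  rewrite (le_trans (gK t tr))// mulrA -expr2 real_normK ?num_real//.
  by rewrite ler_wpM2l ?sqr_ge0// (le_trans (ler_norm _))// lerDl.
have : `|t| * (`|K| + 1) < `|k| / 2 by rewrite -ltr_pdivlMr.
have := ler_normB (t^-1 * (g t - g 0)) (t^-1 * (g t - g 0) - k).
rewrite [X in `|X| <= _ + _](_ : _ = k); last by ring.
move: gt; lra.
Unshelve. all: end_near. Qed.

End FirstVariation.

(** * From orthogonality to divisibility by a(-s)^2 *)

Section Orthogonality.
Variable R : realType.
Local Notation C := R[i].
Local Notation mu := (@lebesgue_measure R).
Local Open Scope complex_scope.
Local Open Scope classical_set_scope.
Implicit Types (a b c d e p q u v : {poly R}) (w t : R).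

(** A positive value would persist on a ball, which has positive measure, whereas the function
    vanishes almost everywhere. *)
Lemma continuous_Rintegral_eq0 (f : R -> R) : (forall w, 0 <= f w) ->
  continuous f -> mu.-integrable setT (EFin \o f) ->
  \int[mu]_w f w = 0 -> forall w, f w = 0.
Proof.
move=> f0 cf fi f_eq0 w; apply/eqP; apply: contraT => fw0.
have fw : 0 < f w by rewrite lt0r fw0 f0.
have mf : measurable_fun setT (EFin \o f).
  by apply/measurable_EFinP; exact: continuous_measurable_fun.
have : (\int[mu]_x `|(EFin \o f) x| = 0)%E.
  under eq_integral do rewrite gee0_abs ?lee_fin//.
  have /fineK <- := integrable_fin_num measurableT fi.
  by rewrite -[X in _ = X]/(0%:E) -f_eq0.
case/(ae_eq_integral_abs mu measurableT mf) => [N [mN N0 fN]].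
have := cf w; move/cvgrPdist_lt => /(_ _ fw) [r /= r0 br].
have bN : ball w r `<=` N.
  move=> x /br fx; apply: fN => /= /(_ I) [] fx0.
  by move: fx; rewrite fx0 subr0 ger0_norm ?ltxx.
have mb : (lebesgue_measure (ball w r) <= lebesgue_measure N)%E.
  by apply: le_measure => //; rewrite inE//; exact: measurable_ball.
move: mb; rewrite N0 (lebesgue_measure_ball _ (ltW r0)) lee_fin leNgt.
by rewrite pmulrn_lgt0// r0.
Qed.

Lemma ev_eq0 p : (forall w, ev p w = 0) -> p = 0.
Proof.
move=> p0; apply/eqP; rewrite -size_poly_eq0 -size_polC size_poly_eq0.
apply: contraT => P0.
have := @max_poly_roots _ _ [seq jw k%:R | k <- iota 0 (size (polC p))] P0.
rewrite size_map size_iota ltnn; apply.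
  by apply/allP => _ /mapP[k _ ->]; apply/eqP; exact: p0.
rewrite map_inj_uniq ?iota_uniq// => j k; rewrite !jwE => -[].
by move/eqP; rewrite eqr_nat => /eqP.
Qed.

(** Bezout's identity, with the cofactor of [b] reduced modulo [a] and the quotient absorbed in [v].
    It serves both the projection and the choice of tangent directions. *)
Lemma coprimep_solve (F : fieldType) (a b c : {poly F}) : coprimep a b -> a != 0 ->
  exists2 u : {poly F}, (size u < size a)%N & exists v : {poly F}, c = b * u - v * a.
Proof.
move=> /Bezout_eq1_coprimepP[[x y] /= xy] a0.
exists ((c * y) %% a); first by rewrite ltn_modp.
exists (- (c * x + b * ((c * y) %/ a))).
have /(congr1 ( *%R b)) := divp_eq (c * y) a.
rewrite mulrDr => /(canLR (addKr _)) <-.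
by rewrite -[LHS]mulr1 -xy; ring.
Qed.

Lemma size_mul_leq_cancel (F : fieldType) (k q : {poly F}) m :
  q != 0 -> (size (k * q)%R <= m + (size q).-1)%N -> (size k <= m)%N.
Proof.
move=> q0; have [->|k0] := eqVneq k 0; first by rewrite size_poly0.
rewrite size_mul//; move: q0; rewrite -size_poly_gt0.
by case: (size q) => // s _; rewrite addnS/= leq_add2r.
Qed.

(** The polynomial [p(-s)], the conjugate of [p] on the imaginary axis. *)
Definition refl_poly p : {poly R} := p \Po (- 'X).

Lemma size_refl p : size (refl_poly p) = size p.
Proof. by rewrite size_comp_poly2// size_polyN size_polyX. Qed.

Lemma polC_refl p : polC (refl_poly p) = polC p \Po (- 'X).
Proof. by rewrite /polC map_comp_poly rmorphN/= map_polyX. Qed.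

Lemma ev_refl p w : ev (refl_poly p) w = conjc (ev p w).
Proof.
rewrite /ev polC_refl horner_comp hornerN hornerX -(horner_map conjc).
have -> : map_poly conjc (polC p) = polC p.
  by rewrite /polC -map_poly_comp; apply: eq_map_poly => x /=; rewrite oppr0.
by congr horner; rewrite jwE /=; simpc.
Qed.

(** The zeros of a(-s) lie in the open right half plane, those of d in the left one. *)
Lemma coprimep_hurwitz_refl a d : hurwitz a -> hurwitz d -> coprimep (refl_poly a) d.
Proof.
move=> ha hd; rewrite -(coprimep_map (real_complex R)).
apply/negPn/negP => /closed_rootP[z]; rewrite root_gcd => /andP[].
rewrite -/(polC _) -/(polC _) polC_refl root_comp hornerN hornerX => /ha + /hd.
by case: z => x y /=; lra.
Qed.

(** Put h = p / (d a) and choose c0 with p a - c0 d = k a(-s)^2. For g = c0 / a^2 the remainder h -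
    g is orthogonal to g, so orthogonality of h to g forces g = 0. *)
Lemma orthogonal_dvdp n a d p : hurwitz a -> hurwitz d ->
  size a = n.+1 -> size d = n.+2 -> (size p <= n.*2.+1)%N ->
  (forall c, (size c <= n.*2)%N ->
     \int[mu]_w (2 * dotc (ev p w / ev (d * a) w) (ev c w / ev (a ^+ 2) w)) = 0) ->
  (refl_poly a) ^+ 2 %| p.
Proof.
move=> ha hd sa sd sp orth; set P := refl_poly a ^+ 2.
have a0 : a != 0 by rewrite -size_poly_gt0 sa.
have d0 : d != 0 by rewrite -size_poly_gt0 sd.
have sra : size (refl_poly a) = n.+1 by rewrite size_refl.
have ra0 : refl_poly a != 0 by rewrite -size_poly_gt0 sra.
have P0 : P != 0 by rewrite expf_neq0.
have sP : size P = n.*2.+1 by rewrite /P expr2 size_mul// sra addnS/= addSn addnn.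
have sda : size (d * a) = n.*2.+2.
  by rewrite size_mul// sa sd addnS/= !addSn addnn.
have sa2 : size (a ^+ 2) = n.*2.+1 by rewrite expr2 size_mul// sa addnS/= addSn addnn.
have sda2 : size (d * a ^+ 2) = (n + n.*2).+2.
  by rewrite size_mul ?expf_neq0// sd sa2 addnS/= !addSn.
have eva w : ev a w != 0 := ev_neq0 w ha.
have evd w : ev d w != 0 := ev_neq0 w hd.
have evra w : conjc (ev a w) != 0 by rewrite conjc_eq0.
have evda w : ev (d * a) w != 0 by rewrite evM mulf_neq0.
have eva2 w : ev (a ^+ 2) w != 0 by rewrite evX expf_neq0.
have evda2 w : ev (d * a ^+ 2) w != 0 by rewrite evM mulf_neq0.
have Pd : coprimep P d by rewrite coprimep_expl// coprimep_hurwitz_refl.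
have Pa : coprimep P a by rewrite coprimep_expl// coprimep_hurwitz_refl.
(* [c0 / a ^ 2] is the orthogonal projection of [p / (d a)]. *)
have [c0 sc0 [v pa]] := coprimep_solve (p * a) Pd P0.
rewrite sP ltnS in sc0; pose k := - v.
have kP : k * P = p * a - c0 * d by rewrite pa /k; ring.
have skP : (size (k * P)%R <= (n + n.*2).+1)%N.
  rewrite kP (leq_trans (size_polyD _ _))// size_polyN geq_max.
  have h1 x : (x <= n.*2.+1 -> (x + n.+1).-1 <= (n + n.*2).+1)%N by lia.
  have h2 x : (x <= n.*2 -> (x + n.+2).-1 <= (n + n.*2).+1)%N by lia.
  apply/andP; split; apply: leq_trans (size_polyMleq _ _) _.
    by rewrite sa; exact: h1.
  by rewrite sd; exact: h2.
have sk : (size k <= n.+1)%N.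
  by apply: size_mul_leq_cancel P0 _; rewrite sP.
pose g w := ev c0 w / ev (a ^+ 2) w.
have hg w : ev p w / ev (d * a) w - g w = ev (k * P) w / ev (d * a ^+ 2) w.
  rewrite kP /g !(evM, evB, evX); field.
  by rewrite eva evd.
(* On the axis the conjugate of g has denominator a(-s)^2, which cancels [P]; only the stable
   denominator d a^2 is left. *)
have hgg w : 2 * dotc (ev (k * P) w / ev (d * a ^+ 2) w) (g w) =
    complex.Re (ev (2 *: (k * refl_poly c0)) w / ev (d * a ^+ 2) w).
  have gJ : conjc (g w) = conjc (ev c0 w) / conjc (ev a w) ^+ 2.
    by rewrite /g evX rmorphM fmorphV rmorphXn.
  rewrite dotcE gJ evZ !(evM, evX) !ev_refl.
  rewrite [RHS](_ : _ = complex.Re (2%:C * (ev k w * conjc (ev a w) ^+ 2 /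
     (ev d w * ev a w ^+ 2) * (conjc (ev c0 w) / conjc (ev a w) ^+ 2)))).
    by rewrite [RHS]cReM/= mul0r subr0.
  by congr complex.Re; field; rewrite eva evd evra.
have int0 : \int[mu]_w (2 * dotc (ev (k * P) w / ev (d * a ^+ 2) w) (g w)) = 0.
  have [||K _ gK] := @dotc_decay _ (k * P) (d * a ^+ 2) c0 (a ^+ 2) _ evda2 _ eva2.
  - by rewrite sda2 ltnS.
  - by rewrite sa2 ltnS.
  under eq_Rintegral do rewrite hgg.
  apply: (@Rintegral_stable _ _ _ K).
  - move=> z; rewrite /polC expr2 !rmorphM !rootM => /orP[/hd|/orP[]/ha] //.
  - rewrite !size_polC sda2 addn2 !ltnS (leq_trans (size_scale_leq _ _))//.
    rewrite (leq_trans (size_polyMleq _ _))// size_refl.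
    have h x y : (x <= n.+1 -> y <= n.*2 -> (x + y).-1 <= n + n.*2)%N by lia.
    exact: h.
  - by move=> w; have := gK w; rewrite -/(g w) hgg.
(* Subtract (h - g, g) = 0 from (h, g) = 0, the hypothesis taken at c = c0. *)
have {int0} gg0 : \int[mu]_w (2 * dotc (g w) (g w)) = 0.
  have ip : mu.-integrable setT (EFin \o fun w =>
      2 * dotc (ev p w / ev (d * a) w) (g w)).
    by apply: integrable_dotc_ev; rewrite ?sda ?sa2.
  have ik : mu.-integrable setT (EFin \o fun w =>
      2 * dotc (ev (k * P) w / ev (d * a ^+ 2) w) (g w)).
    by apply: integrable_dotc_ev; rewrite ?sda2 ?sa2.
  have := orth c0 sc0; rewrite -/g => int1.
  have := RintegralB measurableT ip ik; rewrite int0 int1 subr0 => <-.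
  apply: eq_Rintegral => w _; rewrite -hg -/(g w).
  by rewrite /dotc cReD cImD; case: (g w) => x y; rewrite /=; ring.
have c00 : c0 = 0.
  apply: ev_eq0 => w; apply/eqP.
  have : 2 * dotc (g w) (g w) = 0.
    apply: continuous_Rintegral_eq0 gg0 w => [w||].
    - by rewrite -abs2_dotc mulr_ge0// abs2_ge0.
    - move=> w; apply: cvgM; first exact: cvg_cst.
      by apply: continuous_dotc; exact: ccont_ev.
    - by apply: integrable_dotc_ev; rewrite ?sa2.
  move/eqP; rewrite mulf_eq0 pnatr_eq0/= -abs2_dotc abs2_eq0.
  by rewrite /g mulf_eq0 invr_eq0 (negbTE (eva2 w)) orbF.
(* With c0 = 0, p a = k a(-s)^2, and a(-s)^2 is coprime to a. *)
rewrite -(Gauss_dvdpl _ Pa); move: kP; rewrite c00 mul0r subr0 => <-.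
exact: dvdp_mulIr.
Qed.

(** * Critical points in the coefficient chart *)

Lemma chart_b_coords n p : (size p <= n)%N -> chart_b (coords n p) = p.
Proof.
move=> pn; rewrite /chart_b; under eq_bigr do rewrite mxE.
rewrite -(poly_def n (fun k => p`_k)); apply/polyP => k; rewrite coef_poly.
by case: ltnP => // nk; rewrite nth_default// (leq_trans pn).
Qed.

Lemma chart_bD n (x y : 'rV[R]_n) t :
  chart_b (t *: x + y) = chart_b y + t *: chart_b x.
Proof.
rewrite /chart_b scaler_sumr -big_split/=; apply: eq_bigr => k _.
by rewrite !mxE scalerDl scalerA addrC.
Qed.

Lemma chart_a_coords n a : a \is monic -> size a = n.+1 ->
  chart_a (coords n a) = a.
Proof.
move=> am sa; rewrite /chart_a; under eq_bigr do rewrite mxE.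
rewrite -(poly_def n (fun k => a`_k)); apply/polyP => k.
rewrite coefD coefXn coef_poly; case: ltngtP => [kn|nk|->].
- by rewrite add0r.
- by rewrite addr0 nth_default// sa.
- by move/monicP: am; rewrite /lead_coef sa/= => ->; rewrite addr0.
Qed.

(** The leading coefficient stays 1, so [chart_a] is affine with linear part [chart_b]. *)
Lemma chart_aD n (x y : 'rV[R]_n) t :
  chart_a (t *: x + y) = chart_a y + t *: chart_b x.
Proof. by rewrite /chart_a -!/(chart_b _) chart_bD addrA. Qed.

(** Write c = b u - v a with u, v of degree below n. Then (u, v) is a direction in the chart, and
    the derivative of f along it is this integral divided by 2 pi. *)
Lemma critical_orthogonal n e d a b c : hurwitz d -> size d = n.+2 ->
  (size e <= n.+1)%N -> critical n e d a b -> (size c <= n.*2)%N ->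
  \int[mu]_w (2 * dotc (ev (e * a - b * d) w / ev (d * a) w)
                       (ev c w / ev (a ^+ 2) w)) = 0.
Proof.
move=> hd sd se [[am sa ha sb ab] [df df0]] sc.
have a0 : a != 0 by rewrite -size_poly_gt0 sa.
have [u su [v cE]] := coprimep_solve c ab a0.
(* The size of v a = b u - c is at most 2n and a has degree n, so v is an admissible direction
   too. *)
have sv : (size v <= n)%N.
  apply: size_mul_leq_cancel a0 _.
  have -> : v * a = b * u - c by rewrite cE; ring.
  rewrite (leq_trans (size_polyD _ _))// size_polyN geq_max sa/= addnn sc andbT.
  rewrite (leq_trans (size_polyMleq _ _))// -addnn.
  rewrite sa ltnS in su; apply: leq_trans (leq_add sb su); exact: leq_pred.
have [r r0 [K rK]] : exists2 r : R, 0 < r & exists K : R, forall t, `|t| < r ->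
   `|H2sq (e * (a + t *: u) - (b + t *: v) * d) (d * (a + t *: u))
     - H2sq (e * a - b * d) (d * a)
     - t * ((2 * pi)^-1 * \int[mu]_w (2 *
         dotc (ev (e * a - b * d) w / ev (d * a) w)
              (ev (b * u - v * a) w / ev (a ^+ 2) w)))| <= t ^+ 2 * K.
  by apply: H2sq_expansion => //; rewrite ?sa ?sd ?ltnS// -sa.
rewrite -cE in rK; set J := \int[mu]_w _ in rK *.
pose g t := H2sq (e * (a + t *: u) - (b + t *: v) * d) (d * (a + t *: u)).
have g0E : g 0 = H2sq (e * a - b * d) (d * a) by rewrite /g !scale0r !addr0.
have : (2 * pi)^-1 * J = 0.
  apply: (@quadratic_remainder_derive0 _ g _ K r r0) => [t tr|].
    by rewrite g0E; exact: rK.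
  pose f := @f_chart R n e d; pose p0 := (coords n a, coords n b).
  pose y := (coords n u, coords n v).
  have fy : t^-1 *: ((f \o shift p0) (t *: y) - f p0) @[t --> 0^'] --> 'D_y f p0.
    by have : derivable f p0 y by exact: diff_derivable.
  rewrite (deriveE y df) df0 in fy; apply: cvg_trans fy; apply: near_eq_cvg.
  apply: nearW => t; rewrite /g /f /f_chart /= chart_aD chart_bD.
  rewrite chart_a_coords// !chart_b_coords//; last by rewrite -ltnS -sa.
  by rewrite !scale0r !addr0.
by move/eqP; rewrite mulf_eq0 invr_eq0 mulf_eq0 pnatr_eq0/= (gt_eqF (pi_gt0 R)) => /eqP.
Qed.

End Orthogonality.

(** * Counting critical points and recovering them from solutions *)

(** If no list exhausted [P], every list of elements of [P] could be lengthened, up to size m +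
    1. *)
Lemma finite_enumeration (T : eqType) (P : T -> Prop) (m : nat) :
  (forall s : seq T, uniq s -> (forall x, x \in s -> P x) -> (size s <= m)%N) ->
  exists s : seq T, [/\ uniq s, (size s <= m)%N & forall x, P x <-> x \in s].
Proof.
move=> bound; apply: contrapT => nofin.
have long k : exists s : seq T, [/\ uniq s, forall x, x \in s -> P x & size s = k].
  elim: k => [|k [s [us sP <-]]]; first by exists [::].
  have [x [Px xs]] : exists x, P x /\ x \notin s.
    apply: contrapT => nx; apply: nofin; exists s; split; [by []|exact: bound|].
    move=> x; split=> [Px|/sP//]; apply: contrapT => /negP xs.
    by apply: nx; exists x.
  exists (x :: s); split => //=; first by rewrite xs.
  by move=> z; rewrite inE => /predU1P[->|/sP].
have [s [us sP sm]] := long m.+1.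
by have := bound s us sP; rewrite sm ltnn.
Qed.

Lemma eq_poly_on_points (F : fieldType) (N : nat) (x : 'I_N -> F) (p q : {poly F}) :
  injective x -> (size p <= N)%N -> (size q <= N)%N ->
  (forall i, p.[x i] = q.[x i]) -> p = q.
Proof.
move=> xI pN qN pq; apply/eqP; rewrite -subr_eq0; apply: contraT => pq0.
have := @max_poly_roots _ _ [seq x i | i <- enum 'I_N] pq0.
rewrite size_map size_enum_ord ltnNge (leq_trans (size_polyD _ _)); last first.
  by rewrite size_polyN geq_max pN qN.
apply; last by rewrite map_inj_uniq ?enum_uniq.
by apply/allP => _ /mapP[i _ ->]; rewrite rootE hornerD hornerN pq subrr.
Qed.

Section CriticalPoints.
Variable R : realType.
Local Notation C := R[i].
Local Open Scope complex_scope.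
Implicit Types (a b : {poly R}).

Lemma vdmE N (x : 'I_N -> C) : vdm x = (Vandermonde N (\row_i x i))^T.
Proof. by apply/matrixP => i j; rewrite !mxE. Qed.

Lemma vdm_unitmx N (x : 'I_N -> C) : injective x -> vdm x \in unitmx.
Proof.
move=> xI; rewrite unitmxE vdmE det_tr det_Vandermonde unitfE.
apply/prodf_neq0 => i _; apply/prodf_neq0 => j ij.
by rewrite !mxE subr_eq0 (inj_eq xI) gt_eqF.
Qed.

(** Consequently [Mmat] sends the values at the points -delta_i of a polynomial of degree < N to
    e(delta_i) times its values at the delta_i. *)
Lemma vdm_coefs N (x : 'I_N -> C) (p : {poly C}) : (size p <= N)%N ->
  vdm x *m (\col_j p`_j) = \col_i p.[x i].
Proof.
move=> pN; apply/colP => i; rewrite !mxE (horner_coef_wide _ pN).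
by apply: eq_bigr => j _; rewrite !mxE mulrC.
Qed.

Variables (n : nat) (d e : {poly R}) (dl : 'I_n.+1 -> C).
Hypothesis sd : size d = n.+2.
Hypothesis dE : polC d = \prod_(i < n.+1) ('X - (dl i)%:P).
Hypothesis dlI : injective dl.
Hypothesis dl_lt0 : forall i, complex.Re (dl i) < 0.
Hypothesis se : (size e <= n.+1)%N.
Hypothesis de : coprimep d e.

Let polC_inj : injective (@polC R).
Proof. exact/map_inj_poly/rmorph0/complexI. Qed.

Let ndlI : injective (fun i => - dl i).
Proof. by move=> i j /oppr_inj /dlI. Qed.

Let hd : hurwitz d.
Proof.
move=> z; rewrite dE -big_enum -(big_map _ xpredT (fun z => 'X - z%:P)).
by rewrite root_prod_XsubC => /mapP[i _ ->].
Qed.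

Let d_root i : (polC d).[dl i] = 0.
Proof. by rewrite dE horner_prod (bigD1 i)//= hornerXsubC subrr mul0r. Qed.

(** At a critical point the quotient is a constant; reading off coefficient 0 makes q0 a total
    function of a and b. *)
Definition q0_of a b : R := ((e * a - b * d) %/ refl_poly a ^+ 2)`_0.

(** Both e a - b d and a(-s)^2 have degree at most 2n, the latter exactly, so the quotient is
    constant. If it were 0, d would divide e a, hence a, which has smaller degree. *)
Lemma critical_factor a b : critical n e d a b ->
  q0_of a b != 0 /\ e * a - b * d = q0_of a b *: refl_poly a ^+ 2.
Proof.
move=> crit; have [[am sa ha sb ab] _] := crit.
have a0 : a != 0 by rewrite -size_poly_gt0 sa.
have d0 : d != 0 by rewrite -size_poly_gt0 sd.
have ra0 : refl_poly a != 0 by rewrite -size_poly_gt0 size_refl sa.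
have sP : size (refl_poly a ^+ 2) = n.*2.+1.
  by rewrite expr2 size_mul// size_refl sa addnS/= addSn addnn.
have sp : (size (e * a - b * d)%R <= n.*2.+1)%N.
  rewrite (leq_trans (size_polyD _ _))// size_polyN geq_max.
  have h1 x : (x <= n.+1 -> (x + n.+1).-1 <= n.*2.+1)%N by lia.
  have h2 x : (x <= n -> (x + n.+2).-1 <= n.*2.+1)%N by lia.
  apply/andP; split; apply: leq_trans (size_polyMleq _ _) _.
    by rewrite sa; exact: h1.
  by rewrite sd; exact: h2.
have Pp : refl_poly a ^+ 2 %| e * a - b * d.
  apply: (orthogonal_dvdp ha hd sa sd sp) => c sc.
  exact: critical_orthogonal crit sc.
have pE : e * a - b * d = q0_of a b *: refl_poly a ^+ 2.
  rewrite -[LHS](divpK Pp) /q0_of -mul_polyC; congr (_ * _).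
  apply: size1_polyC; apply: (@size_mul_leq_cancel _ _ (refl_poly a ^+ 2)).
    by rewrite expf_neq0.
  by rewrite divpK// sP.
split=> //; apply/eqP => q00; move: pE; rewrite q00 scale0r => /eqP.
rewrite subr_eq0 => /eqP eabd.
have : d %| a by rewrite -(Gauss_dvdpr _ de) eabd dvdp_mulIr.
by move/(dvdp_leq a0); rewrite sd sa ltnn.
Qed.

Definition xi_of a b : 'cV[C]_n.+1 := \col_i ((q0_of a b)%:C * (polC a).[- dl i]).

Lemma critical_polC a b : critical n e d a b ->
  polC b * polC d = polC e * polC a - (q0_of a b)%:C *: (polC a \Po (- 'X)) ^+ 2.
Proof.
move=> /critical_factor[_ pE]; rewrite -polC_refl.
have -> : (q0_of a b)%:C *: polC (refl_poly a) ^+ 2 = polC (q0_of a b *: refl_poly a ^+ 2).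
  by rewrite /polC map_polyZ rmorphXn.
by rewrite -pE /polC rmorphB !rmorphM/=; ring.
Qed.

(** At a zero delta of d, e(delta) a(delta) = q0 a(-delta)^2; multiply by q0. *)
Lemma xi_of_quadric a b : critical n e d a b -> forall i,
  xi_of a b i ord0 ^+ 2 = (Mmat e dl *m xi_of a b) i ord0.
Proof.
move=> crit i; have [[am sa ha sb ab] _] := crit.
have xiE : xi_of a b =
    vdm (fun i => - dl i) *m \col_j ((q0_of a b)%:C *: polC a)`_j.
  rewrite vdm_coefs ?(leq_trans (size_scale_leq _ _)) ?size_polC ?sa//.
  by apply/colP => j; rewrite !mxE hornerZ.
rewrite {2}xiE /Mmat -!mulmxA (mulmxA (invmx _)) mulVmx ?vdm_unitmx// mul1mx.
rewrite vdm_coefs ?(leq_trans (size_scale_leq _ _)) ?size_polC ?sa//.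
rewrite mul_diag_mx !mxE hornerZ.
have := congr1 (horner^~ (dl i)) (critical_polC crit).
rewrite hornerM d_root mulr0 hornerD hornerN hornerM hornerZ horner_exp.
rewrite horner_comp hornerN hornerX => /eqP; rewrite eq_sym subr_eq0 => /eqP ea.
by rewrite mulrCA ea; ring.
Qed.

(** Otherwise a, of degree n, would vanish at the n + 1 distinct points -delta_i. *)
Lemma xi_of_neq0 a b : critical n e d a b -> xi_of a b != 0.
Proof.
move=> crit; have [[am sa ha sb ab] _] := crit.
have [q0 _] := critical_factor crit.
apply/eqP => xi0; have /(congr1 (fun p : {poly C} => size p)) : polC a = 0.
  apply: (eq_poly_on_points ndlI); rewrite ?size_polC ?sa ?size_poly0// => i.
  move/colP : xi0 => /(_ i); rewrite !mxE horner0 => /eqP.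
  by rewrite mulf_eq0 (inj_eq (@complexI R) _ 0) (negbTE q0) => /eqP.
by rewrite size_polC sa size_poly0.
Qed.

(** Interpolation at the -delta_i recovers q0 a; as a is monic this separates q0 from a, and the
    factorization then gives b. *)
Lemma xi_of_inj a b a' b' : critical n e d a b -> critical n e d a' b' ->
  xi_of a b = xi_of a' b' -> (a, b) = (a', b').
Proof.
move=> crit crit' xiE.
have [[am sa _ _ _] _] := crit; have [[am' sa' _ _ _] _] := crit'.
have [q0 pE] := critical_factor crit; have [q0' pE'] := critical_factor crit'.
have qa : q0_of a b *: a = q0_of a' b' *: a'.
  apply: polC_inj; apply: (eq_poly_on_points ndlI).
  - by rewrite size_polC (leq_trans (size_scale_leq _ _)) ?sa.
  - by rewrite size_polC (leq_trans (size_scale_leq _ _)) ?sa'.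
  - by move=> i; move/colP : xiE => /(_ i); rewrite !mxE /polC !map_polyZ !hornerZ.
have qq : q0_of a b = q0_of a' b'.
  have /(congr1 lead_coef) := qa; rewrite !lead_coefZ.
  by rewrite (monicP am) (monicP am') !mulr1.
have aa : a = a' by move: qa; rewrite qq => /(scalerI q0').
have d0 : d != 0 by rewrite -size_poly_gt0 sd.
suff -> : b = b' by rewrite aa.
apply: (mulIf d0); move: pE'; rewrite -qq -aa -pE => /addrI /oppr_inj.
by [].
Qed.

Lemma critical_enumeration : exists s : seq ({poly R} * {poly R}),
  [/\ uniq s, (size s <= 2 ^ n.+1 - 1)%N &
      forall a b, critical n e d a b <-> (a, b) \in s].
Proof.
have [s us sP|s [us ss sP]] := @finite_enumeration _
    (fun ab : {poly R} * {poly R} => critical n e d ab.1 ab.2) (2 ^ n.+1 - 1).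
  rewrite subn1 -ltnS prednK ?expn_gt0//.
  (* Prepending the solution 0, which no critical point yields, accounts for the - 1. *)
  have := @diagonal_quadrics_solutions_le _ _ (Mmat e dl)
    (0 :: [seq xi_of ab.1 ab.2 | ab <- s]).
  rewrite /= size_map; apply.
    rewrite map_inj_in_uniq ?us ?andbT => [|[a b] [a' b'] /sP crit /sP crit'].
      by apply/mapP => -[ab /sP /xi_of_neq0 /eqP xi0 /esym].
    exact: xi_of_inj.
  move=> x; rewrite inE => /predU1P[-> i|/mapP[ab /sP crit -> i]].
    by rewrite mulmx0 mxE expr0n.
  exact: xi_of_quadric.
by exists s; split => // a b; have := sP (a, b).
Qed.

(** The formula for b is multiplied out by d, so b is unique by cancelling d; a is unique by
    interpolation, since q0 is nonzero. *)
Lemma critical_Xi a b : critical n e d a b ->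
  exists (q0 : C) (xi : 'cV[C]_n.+1),
   [/\ Xi e dl xi,
       (forall i, q0 * (polC a).[- dl i] = xi i ord0),
       polC b * polC d = polC e * polC a - q0 *: (polC a \Po (- 'X)) ^+ 2,
       (forall a' : {poly R}, (size a' <= n.+1)%N ->
          (forall i, q0 * (polC a').[- dl i] = xi i ord0) -> a' = a) &
       (forall b' : {poly R},
          polC b' * polC d = polC e * polC a - q0 *: (polC a \Po (- 'X)) ^+ 2 ->
          b' = b)].
Proof.
move=> crit; have [[am sa ha sb ab] _] := crit.
have [q0 _] := critical_factor crit.
have xiE i : (q0_of a b)%:C * (polC a).[- dl i] = xi_of a b i ord0 by rewrite mxE.
have d0 : polC d != 0 by rewrite -size_poly_gt0 size_polC sd.
have Q0 : (q0_of a b)%:C != 0 by rewrite (inj_eq (@complexI R) _ 0).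
exists (q0_of a b)%:C, (xi_of a b); split => //.
- by split; [exact: xi_of_neq0|exact: xi_of_quadric].
- exact: critical_polC.
- move=> a' sa' a'E; apply: polC_inj; apply: (eq_poly_on_points ndlI) => [||i].
  + by rewrite size_polC.
  + by rewrite size_polC sa.
  + by apply: (mulfI Q0); rewrite a'E xiE.
- move=> b' b'E; apply: polC_inj; apply: (mulIf d0).
  by rewrite b'E (critical_polC crit).
Qed.

End CriticalPoints.

Unset Implicit Arguments.

Theorem theorem6 (R : realType) (N : nat) (d e : {poly R}) (dl : 'I_N -> R[i]) :
  (2 <= N)%N ->
  d \is monic -> size d = N.+1 ->
  polC d = \prod_(i < N) ('X - (dl i)%:P) ->
  injective dl ->
  (forall i, complex.Re (dl i) < 0) ->
  (size e <= N)%N -> coprimep d e ->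
  (exists s : seq ({poly R} * {poly R}),
      [/\ uniq s, (size s <= 2 ^ N - 1)%N &
          forall a b, critical N.-1 e d a b <-> (a, b) \in s])
  /\
  (forall a b, critical N.-1 e d a b ->
     exists (q0 : R[i]) (xi : 'cV[R[i]]_N),
       [/\ Xi e dl xi,
           (forall i, q0 * (polC a).[- dl i] = xi i ord0),
           polC b * polC d = polC e * polC a - q0 *: (polC a \Po (- 'X)) ^+ 2,
           (forall a' : {poly R}, (size a' <= N)%N ->
              (forall i, q0 * (polC a').[- dl i] = xi i ord0) -> a' = a) &
           (forall b' : {poly R},
              polC b' * polC d = polC e * polC a - q0 *: (polC a \Po (- 'X)) ^+ 2 ->
              b' = b)]).
Proof.
case: N dl => // n dl _ _ sd dE dlI dl0 se de; split.
  exact: (critical_enumeration sd dE dlI dl0 se de).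
by move=> a b; exact: (critical_Xi sd dE dlI dl0 se de).
Qed.
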